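(* (Lebesgue number lemma) The system $\mathsf{ACA}_0^\omega+\mathsf{QF\text{-}AC}^{0,1}$ proves: for every sequence $(O_n)_{n\in\mathbb{N}}$ of open sets with $[0,1]\subseteq\bigcup_{n\in\mathbb{N}}O_n$, there is $k\in\mathbb{N}$ such that for all $a,b\in[0,1]$ with $|a-b|<2^{-k}$ there is $n\in\mathbb{N}$ with $(a,b)\subseteq O_n$.
   Context: Framework: Kohlenbach's higher-order reverse mathematics; $\mathsf{RCA}_0^\omega$ is Kohlenbach's base theory (extensional primitive recursive arithmetic in all finite types with $\mathsf{QF\text{-}AC}^{1,0}$); $\mathsf{ACA}_0^\omega$ is $\mathsf{RCA}_0^\omega$ plus $(\exists^2)$: there is $E:\mathbb{N}^\mathbb{N}\to\{0,1\}$ with $(\forall f)[(\exists n)(f(n)=0)\leftrightarrow E(f)=0]$. $\mathsf{QF\text{-}AC}^{0,1}$: for all $Y^2$, if $(\forall n)(\exists f\in\mathbb{N}^\mathbb{N})(Y(f,n)=0)$ then there is $\Phi^{0\to1}$ with $(\forall n)(Y(\Phi(n),n)=0)$. An open set $U\subseteq\mathbb{R}$ is given by $h_U:\mathbb{R}\to\mathbb{R}$, with $x\in U$ meaning $h_U(x)>0$, such that $y\in U$ implies $(\exists N)(\forall z\in B(y,2^{-N}))(z\in U)$; a sequence of open sets is a sequence of representing functions. *)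

(* Defs.v *)
From Stdlib Require Import List.
Import ListNotations.

Set Implicit Arguments.
Unset Strict Implicit.
Unset Printing Implicit Defensive.

(** * The language of arithmetic in all finite types *)

Inductive ty : Type :=
| N : ty
| Arr : ty -> ty -> ty.

Declare Scope ty_scope.
Delimit Scope ty_scope with ty.
Bind Scope ty_scope with ty.
Notation "σ ⇒ τ" := (Arr σ τ) (at level 55, right associativity) : ty_scope.
Open Scope ty_scope.

(* The "type 1" of the literature: elements of Baire space. *)
Notation B := (N ⇒ N).

(* Variables are typed de Bruijn indices. *)
Inductive var : list ty -> ty -> Type :=
| vz : forall Γ σ, var (σ :: Γ) σ
| vs : forall Γ σ τ, var Γ τ -> var (σ :: Γ) τ.

Arguments vz {Γ σ}.
Arguments vs {Γ σ τ} _.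

(* [cK] and [cS] are the combinators usually called Π and Σ; [cRec] is the
   recursor of type-0 values, R_0. *)
Inductive cst : ty -> Type :=
| cZero : cst N
| cSucc : cst (N ⇒ N)
| cK : forall σ τ, cst (σ ⇒ τ ⇒ σ)
| cS : forall ρ σ τ, cst ((ρ ⇒ σ ⇒ τ) ⇒ (ρ ⇒ σ) ⇒ ρ ⇒ τ)
| cRec : cst ((N ⇒ N ⇒ N) ⇒ N ⇒ N ⇒ N).

Inductive tm (Γ : list ty) : ty -> Type :=
| Var : forall τ, var Γ τ -> tm Γ τ
| Cst : forall τ, cst τ -> tm Γ τ
| App : forall σ τ, tm Γ (σ ⇒ τ) -> tm Γ σ -> tm Γ τ.

Arguments Var {Γ τ} _.
Arguments Cst {Γ τ} _.
Arguments App {Γ σ τ} _ _.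

(* The only atomic formulas are equations of type 0. *)
Inductive fm : list ty -> Type :=
| Eq : forall Γ, tm Γ N -> tm Γ N -> fm Γ
| Bot : forall Γ, fm Γ
| Imp : forall Γ, fm Γ -> fm Γ -> fm Γ
| And : forall Γ, fm Γ -> fm Γ -> fm Γ
| Or : forall Γ, fm Γ -> fm Γ -> fm Γ
| All : forall Γ σ, fm (σ :: Γ) -> fm Γ
| Ex : forall Γ σ, fm (σ :: Γ) -> fm Γ.

Arguments Bot {Γ}.
Arguments All {Γ} σ _.
Arguments Ex {Γ} σ _.

Declare Scope fm_scope.
Delimit Scope fm_scope with fm.
Bind Scope fm_scope with fm.
Open Scope fm_scope.

Notation "s ⋅ t" := (App s t) (at level 40, left associativity) : fm_scope.
Notation "s ≐ t" := (Eq s t) (at level 70) : fm_scope.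
Notation "φ ⊓ ψ" := (And φ ψ) (at level 80, right associativity) : fm_scope.
Notation "φ ⊔ ψ" := (Or φ ψ) (at level 85, right associativity) : fm_scope.
Notation "φ ⊃ ψ" := (Imp φ ψ)
  (at level 99, right associativity, ψ at level 200) : fm_scope.
Notation "∀[ σ ] φ" := (All σ φ) (at level 200, φ at level 200) : fm_scope.
Notation "∃[ σ ] φ" := (Ex σ φ) (at level 200, φ at level 200) : fm_scope.

Definition Neg Γ (φ : fm Γ) : fm Γ := φ ⊃ Bot.
Definition Iff Γ (φ ψ : fm Γ) : fm Γ := (φ ⊃ ψ) ⊓ (ψ ⊃ φ).

Notation v0 := (Var vz).
Notation v1 := (Var (vs vz)).
Notation v2 := (Var (vs (vs vz))).
Notation v3 := (Var (vs (vs (vs vz)))).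
Notation v4 := (Var (vs (vs (vs (vs vz))))).
Notation v5 := (Var (vs (vs (vs (vs (vs vz)))))).

Fixpoint qf Γ (φ : fm Γ) : Prop :=
  match φ with
  | Eq _ _ | Bot => True
  | Imp φ ψ | And φ ψ | Or φ ψ => qf φ /\ qf ψ
  | All _ _ | Ex _ _ => False
  end.

(** * Renaming and substitution *)

Definition ren (Γ Δ : list ty) : Type := forall τ, var Γ τ -> var Δ τ.
Definition sub (Γ Δ : list ty) : Type := forall τ, var Γ τ -> tm Δ τ.

Fixpoint ren_tm Γ Δ (r : ren Γ Δ) τ (t : tm Γ τ) : tm Δ τ :=
  match t with
  | Var x => Var (r _ x)
  | Cst c => Cst c
  | App s t => App (ren_tm r s) (ren_tm r t)
  end.

Fixpoint sub_tm Γ Δ (s : sub Γ Δ) τ (t : tm Γ τ) : tm Δ τ :=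
  match t with
  | Var x => s _ x
  | Cst c => Cst c
  | App t u => App (sub_tm s t) (sub_tm s u)
  end.

Definition wk Γ σ τ (t : tm Γ τ) : tm (σ :: Γ) τ := ren_tm (fun _ x => vs x) t.
Arguments wk {Γ σ τ} t.

Definition scons Γ Δ σ (t : tm Δ σ) (s : sub Γ Δ) : sub (σ :: Γ) Δ :=
  fun τ x =>
    match x in var (σ' :: Γ') τ' return tm Δ σ' -> sub Γ' Δ -> tm Δ τ' with
    | vz => fun t _ => t
    | vs y => fun _ s => s _ y
    end t s.

Definition up Γ Δ (s : sub Γ Δ) σ : sub (σ :: Γ) (σ :: Δ) :=
  scons (Var vz) (fun τ x => wk (s τ x)).
Arguments up {Γ Δ} s {σ}.

Fixpoint sub_fm Γ (φ : fm Γ) : forall Δ, sub Γ Δ -> fm Δ :=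
  match φ with
  | Eq t u => fun _ s => Eq (sub_tm s t) (sub_tm s u)
  | Bot => fun _ _ => Bot
  | Imp φ ψ => fun _ s => Imp (sub_fm φ s) (sub_fm ψ s)
  | And φ ψ => fun _ s => And (sub_fm φ s) (sub_fm ψ s)
  | Or φ ψ => fun _ s => Or (sub_fm φ s) (sub_fm ψ s)
  | All σ φ => fun _ s => All σ (sub_fm φ (up s))
  | Ex σ φ => fun _ s => Ex σ (sub_fm φ (up s))
  end.

Definition wk_fm Γ σ (φ : fm Γ) : fm (σ :: Γ) := sub_fm φ (fun _ x => Var (vs x)).
Arguments wk_fm {Γ σ} φ.

Definition inst Γ σ (φ : fm (σ :: Γ)) (t : tm Γ σ) : fm Γ :=
  sub_fm φ (scons t (fun _ x => Var x)).

(** * Classical natural deduction *)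

(* The context [Γ] declares the free (eigen)variables; [T] gives the axioms,
   possibly with free variables. *)
Inductive prv (T : forall Γ, fm Γ -> Prop) :
    forall Γ, list (fm Γ) -> fm Γ -> Prop :=
| prv_ax Γ (H : list (fm Γ)) φ : T Γ φ -> prv T H φ
| prv_hyp Γ (H : list (fm Γ)) φ : In φ H -> prv T H φ
| prv_raa Γ (H : list (fm Γ)) φ : prv T (Neg φ :: H) Bot -> prv T H φ
| prv_impI Γ (H : list (fm Γ)) φ ψ : prv T (φ :: H) ψ -> prv T H (φ ⊃ ψ)
| prv_impE Γ (H : list (fm Γ)) φ ψ : prv T H (φ ⊃ ψ) -> prv T H φ -> prv T H ψ
| prv_andI Γ (H : list (fm Γ)) φ ψ : prv T H φ -> prv T H ψ -> prv T H (φ ⊓ ψ)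
| prv_andE1 Γ (H : list (fm Γ)) φ ψ : prv T H (φ ⊓ ψ) -> prv T H φ
| prv_andE2 Γ (H : list (fm Γ)) φ ψ : prv T H (φ ⊓ ψ) -> prv T H ψ
| prv_orI1 Γ (H : list (fm Γ)) φ ψ : prv T H φ -> prv T H (φ ⊔ ψ)
| prv_orI2 Γ (H : list (fm Γ)) φ ψ : prv T H ψ -> prv T H (φ ⊔ ψ)
| prv_orE Γ (H : list (fm Γ)) φ ψ χ :
    prv T H (φ ⊔ ψ) -> prv T (φ :: H) χ -> prv T (ψ :: H) χ -> prv T H χ
| prv_allI Γ (H : list (fm Γ)) σ (φ : fm (σ :: Γ)) :
    prv T (map wk_fm H) φ -> prv T H (∀[σ] φ)
| prv_allE Γ (H : list (fm Γ)) σ (φ : fm (σ :: Γ)) (t : tm Γ σ) :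
    prv T H (∀[σ] φ) -> prv T H (inst φ t)
| prv_exI Γ (H : list (fm Γ)) σ (φ : fm (σ :: Γ)) (t : tm Γ σ) :
    prv T H (inst φ t) -> prv T H (∃[σ] φ)
| prv_exE Γ (H : list (fm Γ)) σ (φ : fm (σ :: Γ)) ψ :
    prv T H (∃[σ] φ) -> prv T (φ :: map wk_fm H) (wk_fm ψ) ->
    prv T H ψ.

Definition proves (T : forall Γ, fm Γ -> Prop) (φ : fm []) : Prop := prv T [] φ.

(** * The axioms *)

Section Terms.
Context {Γ : list ty}.
Implicit Types m n : tm Γ N.

Definition zero : tm Γ N := Cst cZero.
Definition succ n : tm Γ N := Cst cSucc ⋅ n.
Definition one : tm Γ N := succ zero.
Definition two : tm Γ N := succ one.
Definition rec (f : tm Γ (N ⇒ N ⇒ N)) m n : tm Γ N := Cst cRec ⋅ f ⋅ m ⋅ n.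
End Terms.

(* Equality at higher types is a defined, pointwise notion. *)
Fixpoint eqt τ : forall Γ, tm Γ τ -> tm Γ τ -> fm Γ :=
  match τ with
  | N => fun Γ s t => s ≐ t
  | Arr σ τ => fun Γ s t => ∀[σ] eqt (wk s ⋅ v0) (wk t ⋅ v0)
  end.

(* E-PRA^ω together with QF-AC^{1,0}. *)
Inductive RCA0w : forall Γ, fm Γ -> Prop :=
| ax_refl Γ : RCA0w (Γ := Γ) (∀[N] v0 ≐ v0)
| ax_sym Γ : RCA0w (Γ := Γ) (∀[N] ∀[N] v1 ≐ v0 ⊃ v0 ≐ v1)
| ax_trans Γ : RCA0w (Γ := Γ) (∀[N] ∀[N] ∀[N] v2 ≐ v1 ⊃ v1 ≐ v0 ⊃ v2 ≐ v0)
| ax_succ_neq0 Γ : RCA0w (Γ := Γ) (∀[N] Neg (succ v0 ≐ zero))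
| ax_succ_inj Γ : RCA0w (Γ := Γ) (∀[N] ∀[N] succ v1 ≐ succ v0 ⊃ v1 ≐ v0)
| ax_K Γ σ τ : RCA0w (Γ := Γ) (∀[σ] ∀[τ] eqt (Cst (cK σ τ) ⋅ v1 ⋅ v0) v1)
| ax_S Γ ρ σ τ :
    RCA0w (Γ := Γ) (∀[ρ ⇒ σ ⇒ τ] ∀[ρ ⇒ σ] ∀[ρ]
      eqt (Cst (cS ρ σ τ) ⋅ v2 ⋅ v1 ⋅ v0) (v2 ⋅ v0 ⋅ (v1 ⋅ v0)))
| ax_rec0 Γ : RCA0w (Γ := Γ) (∀[N ⇒ N ⇒ N] ∀[N] rec v1 v0 zero ≐ v0)
| ax_recS Γ :
    RCA0w (Γ := Γ) (∀[N ⇒ N ⇒ N] ∀[N] ∀[N]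
      rec v2 v1 (succ v0) ≐ v2 ⋅ v0 ⋅ rec v2 v1 v0)
| ax_ext Γ ρ τ :
    RCA0w (Γ := Γ) (∀[ρ] ∀[ρ] ∀[ρ ⇒ τ] eqt v2 v1 ⊃ eqt (v0 ⋅ v2) (v0 ⋅ v1))
| ax_qfind Γ (φ : fm (N :: Γ)) :
    qf φ ->
    RCA0w (inst φ zero ⊓
           (∀[N] φ ⊃ sub_fm φ (scons (succ v0) (fun _ x => Var (vs x)))) ⊃
           ∀[N] φ)
| ax_qfac10 Γ :
    RCA0w (Γ := Γ) (∀[B ⇒ N ⇒ N]
      (∀[B] ∃[N] v2 ⋅ v1 ⋅ v0 ≐ zero) ⊃
      ∃[B ⇒ N] ∀[B] v2 ⋅ v0 ⋅ (v1 ⋅ v0) ≐ zero).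

Inductive ACA0w : forall Γ, fm Γ -> Prop :=
| ACA0w_base Γ (φ : fm Γ) : RCA0w φ -> ACA0w φ
| ax_exists2 Γ :
    ACA0w (Γ := Γ) (∃[B ⇒ N] ∀[B]
      (v1 ⋅ v0 ≐ zero ⊔ v1 ⋅ v0 ≐ one) ⊓
      Iff (∃[N] v1 ⋅ v0 ≐ zero) (v1 ⋅ v0 ≐ zero)).

Inductive ACA0w_QFAC01 : forall Γ, fm Γ -> Prop :=
| ACA0w_QFAC01_base Γ (φ : fm Γ) : ACA0w φ -> ACA0w_QFAC01 φ
| ax_qfac01 Γ :
    ACA0w_QFAC01 (Γ := Γ) (∀[B ⇒ N ⇒ N]
      (∀[N] ∃[B] v2 ⋅ v0 ⋅ v1 ≐ zero) ⊃
      ∃[N ⇒ B] ∀[N] v2 ⋅ (v1 ⋅ v0) ⋅ v0 ≐ zero).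

(** * Primitive recursive arithmetic on type 0 *)

(* Bracket abstraction: [lam t] is the combinatory term "λx. t", where [x] is
   the variable of index 0. *)
Fixpoint lam Γ σ τ (t : tm (σ :: Γ) τ) : tm Γ (σ ⇒ τ) :=
  match t with
  | Var x =>
      match x in var (σ' :: Γ') τ' return tm Γ' (σ' ⇒ τ') with
      | @vz Γ σ => Cst (cS σ (σ ⇒ σ) σ) ⋅ Cst (cK σ (σ ⇒ σ)) ⋅ Cst (cK σ σ)
      | vs y => Cst (cK _ _) ⋅ Var y
      end
  | Cst c => Cst (cK _ _) ⋅ Cst c
  | App s t => Cst (cS _ _ _) ⋅ lam s ⋅ lam t
  end.

Section Arithmetic.
Context {Γ : list ty}.
Implicit Types m n p q r : tm Γ N.

(* In [addN], [mulN] and [monus] the step function ignores the recursion index,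
   whence the combinator [cK]. *)
Definition addN m n : tm Γ N := rec (Cst (cK _ _) ⋅ Cst cSucc) m n.
Definition mulN m n : tm Γ N :=
  rec (Cst (cK _ _) ⋅ (Cst cRec ⋅ (Cst (cK _ _) ⋅ Cst cSucc) ⋅ m)) zero n.
Definition predN n : tm Γ N := rec (Cst (cK _ _)) zero n.
Definition monus m n : tm Γ N :=
  rec (Cst (cK _ _) ⋅ (Cst cRec ⋅ Cst (cK _ _) ⋅ zero)) m n.
End Arithmetic.

Section Codes.
Context {Γ : list ty}.
Implicit Types m n a b d p q r : tm Γ N.

Definition pow2 n : tm Γ N := rec (lam (lam (addN v0 v0))) one n.
Definition leN m n : fm Γ := monus m n ≐ zero.
Definition ltN m n : fm Γ := leN (succ m) n.

(* tri n = 0 + 1 + ... + n *)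
Definition tri n : tm Γ N := rec (lam (lam (addN v0 (succ v1)))) zero n.
End Codes.

Section Rationals.
Context {Γ : list ty}.
Implicit Types m n a b c d p q r : tm Γ N.

(* The Cantor pairing; [root p] is the largest w with tri w <= p, found by
   letting w advance at stage k + 1 exactly when tri (w + 1) <= k + 1. *)
Definition pairN m n : tm Γ N := addN (tri (addN m n)) n.
Definition root p : tm Γ N :=
  rec (lam (lam (addN v0 (monus one (monus (tri (succ v0)) (succ v1)))))) zero p.
Definition sndN p : tm Γ N := monus p (tri (root p)).
Definition fstN p : tm Γ N := monus (root p) (sndN p).

(* The code of the rational (a - b) / d, for d > 0; every number codes a
   rational. *)
Definition rat a b d : tm Γ N := pairN (pairN a b) (predN d).
Definition pos q : tm Γ N := fstN (fstN q).
Definition neg q : tm Γ N := sndN (fstN q).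
Definition den q : tm Γ N := succ (sndN q).

(* The code of c / 2^n. *)
Definition dyadic c n : tm Γ N := rat c zero (pow2 n).

Definition qadd q r : tm Γ N :=
  rat (addN (mulN (pos q) (den r)) (mulN (pos r) (den q)))
      (addN (mulN (neg q) (den r)) (mulN (neg r) (den q)))
      (mulN (den q) (den r)).
Definition qsub q r : tm Γ N :=
  rat (addN (mulN (pos q) (den r)) (mulN (neg r) (den q)))
      (addN (mulN (neg q) (den r)) (mulN (pos r) (den q)))
      (mulN (den q) (den r)).
Definition qabs q : tm Γ N :=
  rat (addN (monus (pos q) (neg q)) (monus (neg q) (pos q))) zero (den q).
Definition qlt q r : fm Γ :=
  ltN (addN (mulN (pos q) (den r)) (mulN (neg r) (den q)))
      (addN (mulN (pos r) (den q)) (mulN (neg q) (den r))).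
Definition qle q r : fm Γ :=
  leN (addN (mulN (pos q) (den r)) (mulN (neg r) (den q)))
      (addN (mulN (pos r) (den q)) (mulN (neg q) (den r))).
End Rationals.

(** * Real numbers: fast converging Cauchy sequences of rationals *)

Section Reals.
Context {Γ : list ty}.
Implicit Types x y : tm Γ B.

(* |x_n - x_{n+i}| < 2^{-n} *)
Definition isReal x : fm Γ :=
  ∀[N] ∀[N] qlt (qabs (qsub (wk (wk x) ⋅ v1) (wk (wk x) ⋅ addN v1 v0)))
                (dyadic one v1).

(* |x_n - y_n| <= 2^{-n+1} *)
Definition req x y : fm Γ :=
  ∀[N] qle (qabs (qsub (wk x ⋅ v0) (wk y ⋅ v0))) (dyadic two v0).

(* x_n + 2^{-n+1} < y_n for some n *)
Definition rlt x y : fm Γ :=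
  ∃[N] qlt (qadd (wk x ⋅ v0) (dyadic two v0)) (wk y ⋅ v0).

(* x_n <= y_n + 2^{-n+1} for all n *)
Definition rle x y : fm Γ :=
  ∀[N] qle (wk x ⋅ v0) (qadd (wk y ⋅ v0) (dyadic two v0)).

Definition rconst (q : tm Γ N) : tm Γ B := Cst (cK _ _) ⋅ q.
Definition rzero : tm Γ B := rconst (dyadic zero zero).
Definition rone : tm Γ B := rconst (dyadic one zero).
Definition rpow2neg (k : tm Γ N) : tm Γ B := rconst (dyadic one k).

(* The index shift keeps the difference fast converging. *)
Definition rsub x y : tm Γ B :=
  lam (qsub (wk x ⋅ succ v0) (wk y ⋅ succ v0)).
Definition rabs x : tm Γ B := lam (qabs (wk x ⋅ v0)).
End Reals.

Notation "∀ℝ φ" := (All B (Imp (isReal v0) φ))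
  (at level 200, φ at level 200) : fm_scope.

(** * Open sets *)

Section OpenSets.
Context {Γ : list ty}.
Implicit Types (x : tm Γ B) (h : tm Γ (B ⇒ B)).

(* h represents a function from ℝ to ℝ: it maps reals to reals and respects
   equality of reals. *)
Definition isRealFun h : fm Γ :=
  (∀ℝ isReal (wk h ⋅ v0)) ⊓
  (∀ℝ ∀ℝ req v1 v0 ⊃ req (wk (wk h) ⋅ v1) (wk (wk h) ⋅ v0)).

Definition mem x h : fm Γ := rlt rzero (h ⋅ x).

Definition inBall (z y : tm Γ B) (k : tm Γ N) : fm Γ :=
  rlt (rabs (rsub z y)) (rpow2neg k).

Definition in01 x : fm Γ := rle rzero x ⊓ rle x rone.
End OpenSets.

Definition isOpen Γ (h : tm Γ (B ⇒ B)) : fm Γ :=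
  isRealFun h ⊓
  (∀ℝ mem v0 (wk h) ⊃
     ∃[N] ∀ℝ inBall v0 v2 v1 ⊃ mem v0 (wk (wk (wk h)))).

(* Main.v *)
From HB Require Import structures.
From mathcomp Require Import all_boot all_order all_algebra.
From mathcomp Require Import ring lra.
From mathcomp.classical Require Import boolp classical_sets filter.
From Stdlib Require Cantor.
From Stdlib Require Import List.
Require Import Defs.
Import ListNotations.

(** By Henkin's completeness theorem it suffices to verify the statement in an
    arbitrary model of the axioms, and after dividing by provable extensional
    equality the model is extensional with genuine equality.  Its type-0 part is a
    possibly nonstandard semiring, which embeds in an ordered field [F]; there the
    rational codes take values, and the formulas about reals become inequalities
    in [F].  With (∃²), induction and QF-AC^{0,1} hold in the model for all
    arithmetical formulas.

    Suppose no [k] is a Lebesgue number.  Then for every [k] there are a rational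
    [c_k] of [0, 1], up to [2 * 2^-k], and points [z_{k,n}] outside [O_n], all
    within [3 * 2^-k] of [c_k]; two uses of choice give these as sequences.  The
    limit superior [x] of the [c_k] is a real of [0, 1], approximated up to [2^-n]
    by [d / 2^n] for the largest [d] that [2^n c_k] reaches for infinitely many
    [k].  So [x] lies in some [O_n] together with a ball, and this ball contains
    some [z_{k,n}]. *)

Set Implicit Arguments.
Unset Strict Implicit.
Unset Printing Implicit Defensive.

(** * Substitution *)

Definition valuation (P : ty -> Type) (Γ : list ty) : Type :=
  forall τ, var Γ τ -> P τ.

Definition vcons (P : ty -> Type) Γ σ (a : P σ) (f : valuation P Γ) :
    valuation P (σ :: Γ) :=
  fun τ x =>
    match x in var (σ' :: Γ') τ' return P σ' -> valuation P Γ' -> P τ' with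
    | vz _ _ => fun a _ => a
    | vs _ _ _ y => fun _ f => f _ y
    end a f.

Lemma var_nilP (P : Type) τ : var [] τ -> P.
Proof. by move=> x; inversion x. Qed.

Lemma var_consP Γ σ (P : forall τ, var (σ :: Γ) τ -> Prop) :
  P σ vz -> (forall τ y, P τ (vs y)) -> forall τ x, P τ x.
Proof.
move=> Pz Ps τ x.
exact: (match x in var (σ' :: Γ') τ' return
   forall (Q : forall τ, var (σ' :: Γ') τ -> Prop),
   Q σ' vz -> (forall τ y, Q τ (vs y)) -> Q τ' x with
   | vz _ _ => fun Q q _ => q | vs _ _ _ y => fun Q _ q => q _ y end P Pz Ps).
Qed.

Lemma valuation_ext (P : ty -> Type) Γ (f g : valuation P Γ) :
  (forall τ x, f τ x = g τ x) -> f = g.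
Proof.
by move=> fg; do 2![apply: functional_extensionality_dep => ?]; exact: fg.
Qed.

Lemma vcons_eta (P : ty -> Type) Γ σ (a : P σ) (g : valuation P Γ)
    (f : valuation P (σ :: Γ)) :
  f σ vz = a -> (forall τ x, f τ (vs x) = g τ x) -> f = vcons a g.
Proof. by move=> fz fs; apply: valuation_ext; apply: var_consP. Qed.

Lemma valuation_nil (P : ty -> Type) (f g : valuation P []) : f = g.
Proof. by apply: valuation_ext => τ x; apply: var_nilP x. Qed.

Lemma ren_tm_sub Γ Δ (r : ren Γ Δ) τ (t : tm Γ τ) :
  ren_tm r t = sub_tm (fun τ x => Var (r τ x)) t.
Proof. by elim: t => //= ? ? t -> u ->. Qed.

Lemma sub_tm_comp Γ Δ Θ (s : sub Γ Δ) (s' : sub Δ Θ) τ (t : tm Γ τ) :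
  sub_tm s' (sub_tm s t) = sub_tm (fun τ x => sub_tm s' (s τ x)) t.
Proof. by elim: t => //= ? ? t -> u ->. Qed.

Lemma sub_tm_Var Γ τ (t : tm Γ τ) : sub_tm (fun _ x => Var x) t = t.
Proof. by elim: t => //= ? ? t -> u ->. Qed.

Lemma sub_tm_wk Γ Δ σ (s : sub (σ :: Γ) Δ) τ (t : tm Γ τ) :
  sub_tm s (wk t) = sub_tm (fun τ x => s τ (vs x)) t.
Proof. by rewrite /wk ren_tm_sub sub_tm_comp. Qed.

Lemma wk_sub_tm Γ Δ σ (s : sub Γ Δ) τ (t : tm Γ τ) :
  wk (σ := σ) (sub_tm s t) = sub_tm (fun τ x => wk (s τ x)) t.
Proof. by elim: t => //= ? ? t <- u <-. Qed.

Lemma sub_tm_up_wk Γ Δ σ (s : sub Γ Δ) τ (t : tm Γ τ) :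
  sub_tm (up s) (wk t) = wk (σ := σ) (sub_tm s t).
Proof. by rewrite sub_tm_wk wk_sub_tm. Qed.

Lemma up_comp Γ Δ Θ σ (s : sub Γ Δ) (s' : sub Δ Θ) :
  (fun τ x => sub_tm (up s') (up (σ := σ) s τ x)) =
  up (fun τ x => sub_tm s' (s τ x)).
Proof. by apply: vcons_eta => // τ x; exact: sub_tm_up_wk. Qed.

Lemma up_Var Γ σ :
  up (fun τ (x : var Γ τ) => Var x) = (fun τ (x : var (σ :: Γ) τ) => Var x).
Proof. by apply/esym/vcons_eta. Qed.

Lemma sub_fm_comp Γ (φ : fm Γ) Δ Θ (s : sub Γ Δ) (s' : sub Δ Θ) :
  sub_fm (sub_fm φ s) s' = sub_fm φ (fun τ x => sub_tm s' (s τ x)).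
Proof.
elim: φ Δ Θ s s' => {Γ} //=.
- by move=> Γ t u Δ Θ s s'; rewrite !sub_tm_comp.
1-3: by move=> Γ φ IHφ ψ IHψ Δ Θ s s'; rewrite IHφ IHψ.
1-2: by move=> Γ σ φ IHφ Δ Θ s s'; rewrite IHφ up_comp.
Qed.

Lemma sub_fm_Var Γ (φ : fm Γ) : sub_fm φ (fun _ x => Var x) = φ.
Proof.
elim: φ => {Γ} //=.
- by move=> Γ t u; rewrite !sub_tm_Var.
1-3: by move=> Γ φ -> ψ ->.
1-2: by move=> Γ σ φ IHφ; rewrite up_Var IHφ.
Qed.

Lemma inst_up Γ Δ σ (φ : fm (σ :: Γ)) (s : sub Γ Δ) (t : tm Δ σ) :
  inst (sub_fm φ (up s)) t = sub_fm φ (scons t s).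
Proof.
rewrite /inst sub_fm_comp; congr sub_fm; apply: vcons_eta => // τ x /=.
by rewrite sub_tm_wk /= sub_tm_Var.
Qed.

Lemma sub_inst Γ Δ σ (φ : fm (σ :: Γ)) (t : tm Γ σ) (s : sub Γ Δ) :
  sub_fm (inst φ t) s = inst (sub_fm φ (up s)) (sub_tm s t).
Proof. by rewrite inst_up /inst sub_fm_comp; congr sub_fm; exact: vcons_eta. Qed.

Lemma wk_fm_sub Γ Δ σ (φ : fm Γ) (s : sub Γ Δ) :
  wk_fm (σ := σ) (sub_fm φ s) = sub_fm φ (fun τ x => wk (s τ x)).
Proof.
rewrite /wk_fm sub_fm_comp; congr sub_fm; apply: valuation_ext => τ x.
by rewrite /wk ren_tm_sub.
Qed.

Lemma sub_wk_fm Γ Δ σ (φ : fm Γ) (s : sub (σ :: Γ) Δ) :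
  sub_fm (wk_fm φ) s = sub_fm φ (fun τ x => s τ (vs x)).
Proof. exact: sub_fm_comp. Qed.

Lemma inst_wk_up_vz Γ σ (φ : fm (σ :: Γ)) :
  inst (sub_fm φ (up (fun _ x => Var (vs x)))) (Var vz) = φ.
Proof. by rewrite inst_up -[RHS]sub_fm_Var; congr sub_fm; exact/esym/vcons_eta. Qed.

(** * Natural deduction *)

Section Deduction.
Variable T : forall Γ, fm Γ -> Prop.
Hypothesis T_sub : forall Γ Δ (φ : fm Γ) (s : sub Γ Δ), T φ -> T (sub_fm φ s).

Lemma incl_cons_cons A (x : A) s s' : incl s s' -> incl (x :: s) (x :: s').
Proof. by move=> ss'; apply: (incl_app_app (incl_refl [x])). Qed.

Lemma prv_mono Γ (H H' : list (fm Γ)) φ : incl H H' -> prv T H φ -> prv T H' φ.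
Proof.
move=> HH' d; elim: d H' HH' => {Γ H φ} *.
all: by econstructor; eauto using incl_cons_cons, incl_map.
Qed.

Lemma prv_cons Γ (H : list (fm Γ)) φ ψ : prv T H φ -> prv T (ψ :: H) φ.
Proof. exact/prv_mono/incl_tl/incl_refl. Qed.

Lemma prv_cut Γ (H : list (fm Γ)) φ ψ : prv T H φ -> prv T (φ :: H) ψ -> prv T H ψ.
Proof. by move=> dφ dψ; exact: prv_impE (prv_impI dψ) dφ. Qed.

Lemma prv_contra Γ (H : list (fm Γ)) φ ψ : prv T H (Neg φ) -> prv T (φ :: H) ψ.
Proof.
move=> d; apply/prv_raa/prv_cons; apply: prv_impE (prv_cons _ d) _.
by apply: prv_hyp; left.
Qed.

Lemma map_wk_sub Γ Δ σ (H : list (fm Γ)) (s : sub Γ Δ) :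
  map (fun φ => sub_fm φ (up s)) (map (wk_fm (σ := σ)) H) =
  map wk_fm (map (fun φ => sub_fm φ s) H).
Proof. by rewrite !map_map; apply: map_ext => φ; rewrite sub_wk_fm wk_fm_sub. Qed.

Lemma prv_sub Γ (H : list (fm Γ)) φ : prv T H φ ->
  forall Δ (s : sub Γ Δ), prv T (map (fun ψ => sub_fm ψ s) H) (sub_fm φ s).
Proof.
elim=> {Γ H φ} /=; try by move=> *; econstructor; eauto.
- by move=> Γ H φ Hφ Δ s; apply: prv_hyp; exact: (in_map (fun ψ => sub_fm ψ s)).
- by move=> Γ H σ φ _ IH Δ s; apply: prv_allI; rewrite -map_wk_sub.
- by move=> Γ H σ φ t _ IH Δ s; rewrite sub_inst; apply: prv_allE.
- by move=> Γ H σ φ t _ IH Δ s; apply: (prv_exI (t := sub_tm s t)); rewrite -sub_inst.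
- move=> Γ H σ φ ψ _ IHφ _ IHψ Δ s; apply: prv_exE (IHφ Δ s) _.
  by rewrite -map_wk_sub wk_fm_sub; have := IHψ _ (up s); rewrite sub_wk_fm.
Qed.

Lemma prv_wk Γ σ (H : list (fm Γ)) φ :
  prv T H φ -> prv T (map (wk_fm (σ := σ)) H) (wk_fm φ).
Proof. by move=> d; exact: prv_sub d _ _. Qed.

Lemma prv_forall_of_not_exists_not Γ (H : list (fm Γ)) σ (φ : fm (σ :: Γ)) :
  prv T H (Neg (∃[σ] Neg φ)) -> prv T H (∀[σ] φ).
Proof.
move=> d; apply/prv_allI/prv_raa.
apply: prv_impE (prv_cons _ (prv_wk σ d)) _.
apply: (prv_exI (t := Var vz)); rewrite (inst_wk_up_vz (Neg φ)).
by apply: prv_hyp; left.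
Qed.

End Deduction.

(** * Countability of the syntax *)

Import GenTree.

Fixpoint ty_code (σ : ty) : tree nat :=
  match σ with
  | N => Leaf 0
  | Arr σ τ => Node 0 [ty_code σ; ty_code τ]
  end.

Lemma ty_code_inj : injective ty_code.
Proof. by elim=> [|σ IHσ τ IHτ] [|σ' τ'] //= [] /IHσ -> /IHτ ->. Qed.

HB.instance Definition _ := Equality.copy ty (inj_type ty_code_inj).

Fixpoint var_code Γ τ (x : var Γ τ) : nat :=
  match x with
  | vz _ _ => 0
  | vs _ _ _ y => (var_code y).+1
  end.

Lemma var_code_inj Γ τ (x : var Γ τ) τ' (x' : var Γ τ') :
  var_code x = var_code x' -> existT (var Γ) τ x = existT _ τ' x'.
Proof.
elim: x τ' x' => {Γ τ} [Γ σ|Γ σ τ x IHx]; apply: var_consP => //= τ' y [] /IHx xy.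
exact: (f_equal (fun p => existT (var (σ :: Γ)) _ (vs (projT2 p))) xy).
Qed.

Definition cst_code τ (c : cst τ) : tree nat :=
  match c with
  | cZero => Node 0 []
  | cSucc => Node 1 []
  | cK σ τ => Node 2 [ty_code σ; ty_code τ]
  | cS ρ σ τ => Node 3 [ty_code ρ; ty_code σ; ty_code τ]
  | cRec => Node 4 []
  end.

Lemma cst_code_inj τ (c : cst τ) τ' (c' : cst τ') :
  cst_code c = cst_code c' -> existT cst τ c = existT _ τ' c'.
Proof.
case: c => [||σ1 σ2|σ1 σ2 σ3|]; case: c' => [||τ1 τ2|τ1 τ2 τ3|] //= [].
  by move=> /ty_code_inj -> /ty_code_inj ->.
by move=> /ty_code_inj -> /ty_code_inj -> /ty_code_inj ->.
Qed.

Fixpoint tm_code Γ τ (t : tm Γ τ) : tree nat :=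
  match t with
  | Var _ x => Leaf (var_code x)
  | Cst _ c => Node 0 [cst_code c]
  | App _ _ t u => Node 1 [tm_code t; tm_code u]
  end.

Lemma tm_code_inj Γ τ (t : tm Γ τ) τ' (t' : tm Γ τ') :
  tm_code t = tm_code t' -> existT (tm Γ) τ t = existT _ τ' t'.
Proof.
elim: t τ' t' => {τ} [τ x|τ c|σ τ t IHt u IHu] τ' [τ'' x'|τ'' c'|σ' τ'' t' u'] //= [].
- move=> /var_code_inj xx'.
  exact: (f_equal (fun p => existT (tm Γ) _ (Var (projT2 p))) xx').
- move=> /cst_code_inj cc'.
  exact: (f_equal (fun p => existT (tm Γ) _ (Cst (projT2 p))) cc').
- move=> /IHt tt' /IHu uu'; have [eσ eτ] := existT_inj1 tt'; subst σ' τ''.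
  by rewrite (existT_inj2 tt') (existT_inj2 uu').
Qed.

Fixpoint fm_code Γ (φ : fm Γ) : tree nat :=
  match φ with
  | Eq _ t u => Node 0 [tm_code t; tm_code u]
  | Bot _ => Node 1 []
  | Imp _ φ ψ => Node 2 [fm_code φ; fm_code ψ]
  | And _ φ ψ => Node 3 [fm_code φ; fm_code ψ]
  | Or _ φ ψ => Node 4 [fm_code φ; fm_code ψ]
  | All _ σ φ => Node 5 [ty_code σ; fm_code φ]
  | Ex _ σ φ => Node 6 [ty_code σ; fm_code φ]
  end.

Lemma fm_code_inj Γ : injective (@fm_code Γ).
Proof.
elim=> {Γ}.
- move=> Γ t u ψ; move: t u; case: ψ => //= Γ' t' u' t u [].
  move=> /tm_code_inj tt' /tm_code_inj uu'.
  by rewrite (existT_inj2 tt') (existT_inj2 uu').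
- by move=> Γ; case.
1-3: move=> Γ φ IHφ φ' IHφ' ψ; move: φ IHφ φ' IHφ'; case: ψ => //=.
1-3: by move=> Γ' ψ ψ' φ IHφ φ' IHφ' [] /IHφ -> /IHφ' ->.
1-2: move=> Γ σ φ IHφ ψ; move: φ IHφ; case: ψ => //= Γ' σ' ψ φ IHφ [].
1-2: by move=> /ty_code_inj eσ; subst σ'; move=> /IHφ ->.
Qed.

Definition fm_rank Γ (φ : fm Γ) : nat := pickle (fm_code φ).

Lemma fm_rank_inj Γ : injective (@fm_rank Γ).
Proof. by move=> φ ψ /(pcan_inj pickleK)/fm_code_inj. Qed.

Definition fm_enum Γ (j : nat) : fm Γ :=
  @xget {classic fm Γ} Bot [set φ | fm_rank φ = j].

Lemma fm_rankK Γ (φ : fm Γ) : fm_enum Γ (fm_rank φ) = φ.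
Proof. by apply: (@xget_unique {classic fm Γ}) => // ψ /fm_rank_inj. Qed.

(** * Structures and satisfaction *)

Record structure := Structure {
  dom : ty -> Type;
  ap : forall σ τ, dom (σ ⇒ τ) -> dom σ -> dom τ;
  icst : forall τ, cst τ -> dom τ;
  ieq : dom N -> dom N -> Prop }.

Definition env (M : structure) : list ty -> Type := valuation (dom M).

Definition enil M : env M [] := fun τ x => var_nilP (dom M τ) x.
Definition econs M Γ σ (a : dom M σ) (ρ : env M Γ) : env M (σ :: Γ) := vcons a ρ.

Fixpoint eval M Γ τ (t : tm Γ τ) (ρ : env M Γ) : dom M τ :=
  match t with
  | Var _ x => ρ _ x
  | Cst _ c => icst M c
  | App _ _ t u => ap (eval t ρ) (eval u ρ)
  end.

Fixpoint sat M Γ (φ : fm Γ) : env M Γ -> Prop :=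
  match φ with
  | Eq _ t u => fun ρ => ieq (eval t ρ) (eval u ρ)
  | Bot _ => fun _ => False
  | Imp _ φ ψ => fun ρ => sat φ ρ -> sat ψ ρ
  | And _ φ ψ => fun ρ => sat φ ρ /\ sat ψ ρ
  | Or _ φ ψ => fun ρ => sat φ ρ \/ sat ψ ρ
  | All _ σ φ => fun ρ => forall a : dom M σ, sat φ (econs a ρ)
  | Ex _ σ φ => fun ρ => exists a : dom M σ, sat φ (econs a ρ)
  end.

Definition models (M : structure) (T : forall Γ, fm Γ -> Prop) : Prop :=
  forall Γ (φ : fm Γ) (ρ : env M Γ), T Γ φ -> sat φ ρ.

Section Satisfaction.
Variable M : structure.

Lemma sat_Imp Γ (φ ψ : fm Γ) (ρ : env M Γ) : sat (φ ⊃ ψ) ρ = (sat φ ρ -> sat ψ ρ).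
Proof. by []. Qed.

Lemma sat_Neg Γ (φ : fm Γ) (ρ : env M Γ) : sat (Neg φ) ρ = ~ sat φ ρ.
Proof. by []. Qed.

Lemma sat_And Γ (φ ψ : fm Γ) (ρ : env M Γ) : sat (φ ⊓ ψ) ρ = (sat φ ρ /\ sat ψ ρ).
Proof. by []. Qed.

Lemma sat_Or Γ (φ ψ : fm Γ) (ρ : env M Γ) : sat (φ ⊔ ψ) ρ = (sat φ ρ \/ sat ψ ρ).
Proof. by []. Qed.

Lemma sat_All_iff Γ σ (φ : fm (σ :: Γ)) (ρ : env M Γ) (P : dom M σ -> Prop) :
  (forall a, sat φ (econs a ρ) <-> P a) -> sat (All σ φ) ρ <-> forall a, P a.
Proof. by move=> φP; split=> all a; apply/φP; exact: all. Qed.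

Lemma sat_Ex_iff Γ σ (φ : fm (σ :: Γ)) (ρ : env M Γ) (P : dom M σ -> Prop) :
  (forall a, sat φ (econs a ρ) <-> P a) -> sat (Ex σ φ) ρ <-> exists a, P a.
Proof. by move=> φP; split=> -[a /φP]; exists a. Qed.

End Satisfaction.

(** * Henkin's completeness theorem *)

Section Completeness.
Local Open Scope classical_set_scope.
Variable T : forall Γ, fm Γ -> Prop.
Hypothesis T_sub : forall Γ Δ (φ : fm Γ) (s : sub Γ Δ), T φ -> T (sub_fm φ s).
Variable φ0 : fm [].
Hypothesis φ0_unprovable : ~ prv T [] φ0.

Definition consistent Γ (H : list (fm Γ)) : Prop := ~ prv T H Bot.

(* [agenda i j] is the j-th formula over the context of stage i, weakened to the
   current context. *)
Record stage := Stage {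
  ctx : list ty;
  hyps : list (fm ctx);
  agenda : nat -> nat -> fm ctx }.

Definition decide Γ (H : list (fm Γ)) (φ : fm Γ) : fm Γ :=
  if pselect (consistent (φ :: H)) then φ else Neg φ.

Definition witness Γ (φ : fm Γ) : {σ & list (fm (σ :: Γ))} :=
  match φ with
  | Ex Γ σ ψ => existT (fun σ => list (fm (σ :: Γ))) σ [ψ]
  | φ => existT (fun σ => list (fm (σ :: _))) N []
  end.

Definition current (S : stage) (m : nat) : fm (ctx S) :=
  let: (i, j) := Cantor.of_nat m in decide (hyps S) (agenda S i j).

Definition next (m : nat) (S : stage) : stage :=
  let φ := current S m in
  {| ctx := projT1 (witness φ) :: ctx S;
     hyps := app (projT2 (witness φ)) (map wk_fm (φ :: hyps S));
     agenda i j := if i == m.+1 then fm_enum _ j else wk_fm (agenda S i j) |}.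

Fixpoint chain (m : nat) : stage :=
  match m with
  | 0 => {| ctx := []; hyps := [Neg φ0]; agenda _ j := fm_enum [] j |}
  | m.+1 => next m (chain m)
  end.

Local Notation Γ_ m := (ctx (chain m)).
Local Notation H_ m := (hyps (chain m)).

Lemma decide_consistent Γ (H : list (fm Γ)) φ :
  consistent H -> consistent (decide H φ :: H).
Proof.
rewrite /decide => cH; case: pselect => //= /contrapT dφ dN; apply: cH.
exact: prv_impE (prv_impI dN) (prv_impI dφ).
Qed.

Lemma decide_prv Γ (H : list (fm Γ)) φ : consistent H -> prv T H φ -> decide H φ = φ.
Proof.
rewrite /decide => cH dφ; case: pselect => // - [] d; apply: cH.
exact: prv_cut dφ d.
Qed.

Lemma witness_consistent Γ (H : list (fm Γ)) φ :
  consistent (φ :: H) -> consistent (app (projT2 (witness φ)) (map wk_fm (φ :: H))).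
Proof.
have fresh Δ (K : list (fm Δ)) : consistent K -> consistent (map (wk_fm (σ := N)) K).
  by move=> cK d; apply: cK; apply: (@prv_allE T _ _ N Bot zero); apply: prv_allI.
move: H; case: φ; try by move=> *; apply: fresh.
move=> Δ σ ψ H c d; apply: c; apply: (@prv_exE T Δ _ σ ψ Bot _ d).
by apply: prv_hyp; left.
Qed.

Lemma chain_consistent m : consistent (H_ m).
Proof.
elim: m => [|m IHm]; first by move=> d; apply: φ0_unprovable; apply: prv_raa.
apply: witness_consistent; rewrite /current; case: Cantor.of_nat => i j.
exact: decide_consistent.
Qed.

Lemma prv_chainS m (φ : fm (Γ_ m)) : prv T (H_ m) φ -> prv T (H_ m.+1) (wk_fm φ).
Proof.
move=> /(prv_wk T_sub (projT1 (witness (current (chain m) m)))); apply: prv_mono.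
exact/incl_appr/incl_tl/incl_refl.
Qed.

Lemma prv_current m (ψ : fm (Γ_ m)) :
  current (chain m) m = ψ -> prv T (H_ m.+1) (wk_fm ψ).
Proof. by move=> <-; apply: prv_hyp; apply: in_or_app; right; left. Qed.

Lemma witness_in Γ (φ : fm Γ) σ (ψ : fm (σ :: Γ)) : φ = Ex σ ψ ->
  exists x : var (projT1 (witness φ) :: Γ) σ,
    In (sub_fm ψ (scons (Var x) (fun _ y => Var (vs y)))) (projT2 (witness φ)).
Proof.
move=> ->; exists vz; left; rewrite -[LHS]sub_fm_Var; congr sub_fm.
exact: vcons_eta.
Qed.

Definition coherent_from n (ψ : forall m, fm (Γ_ m)) : Prop :=
  forall m, n <= m -> ψ m.+1 = wk_fm (ψ m).

Lemma coherent_prv n ψ m : coherent_from n ψ -> n <= m -> prv T (H_ m) (ψ m) ->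
  \forall k \near \oo, prv T (H_ k) (ψ k).
Proof.
move=> cψ le_nm dm; exists m => // k /= /subnK <-; elim: (k - m) => [//|i di].
rewrite -[_ + m]/(i + m).+1 cψ; first exact: prv_chainS.
exact: leq_trans le_nm (leq_addl _ _).
Qed.

Lemma coherent_decided n ψ : coherent_from n ψ ->
  exists2 m, n <= m & current (chain m) m = decide (H_ m) (ψ m).
Proof.
move=> cψ; pose j := fm_rank (ψ n).
have agenda_n : agenda (chain n) n j = ψ n.
  by rewrite -[RHS]fm_rankK -/j; case: (n) => //= n'; rewrite eqxx.
have agenda_later k : agenda (chain (k + n)) n j = ψ (k + n).
  elim: k => [//|k IHk]; rewrite -[_ + n]/(k + n).+1 cψ ?leq_addl //= IHk ltn_eqF //.
  by rewrite ltnS leq_addl.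
pose m := Cantor.to_nat (n, j).
have le_nm : n <= m.
  have /leP := Cantor.to_nat_non_decreasing n j.
  by apply: leq_trans; rewrite leq_addl.
exists m => //; have := agenda_later (m - n); rewrite subnK // => <-.
by rewrite /current {2}/m Cantor.cancel_of_to.
Qed.

(* The elements of the Henkin model are terms over the limit of the growing contexts:
   families of terms, one for each stage, that eventually are weakenings of one
   another.  Both equality and truth are read off at all late stages. *)
Record thread τ := Thread {
  at_stage :> forall m, tm (Γ_ m) τ;
  thread_coherent : \forall m \near \oo, at_stage m.+1 = wk (at_stage m) }.

Fixpoint default_tm Γ τ : tm Γ τ :=
  match τ with
  | N => zero
  | Arr σ τ => Cst (cK τ σ) ⋅ default_tm Γ τ
  end.

Fixpoint weaken_to m τ (t : tm (Γ_ m) τ) k : tm (Γ_ k) τ :=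
  match m =P k with
  | ReflectT mk => ecast k (tm (Γ_ k) τ) mk t
  | ReflectF _ => if k is k'.+1 then wk (weaken_to t k') else default_tm [] τ
  end.

Lemma weaken_to_id m τ (t : tm (Γ_ m) τ) : weaken_to t m = t.
Proof. by case: (m) t => [|m'] t /=; case: eqP => // e; rewrite eq_axiomK. Qed.

Lemma weaken_toS m τ (t : tm (Γ_ m) τ) k :
  m <= k -> weaken_to t k.+1 = wk (weaken_to t k).
Proof. by move=> le_mk /=; case: eqP => // mk; exfalso; move: le_mk; rewrite mk ltnn. Qed.

Definition thread_of m τ (t : tm (Γ_ m) τ) : thread τ :=
  Thread (ex_intro2 _ (fun n => _) m I (@weaken_toS m τ t)).

Definition tuple_at Γ (ρ : valuation thread Γ) m : sub Γ (Γ_ m) := fun τ x => ρ τ x m.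

Lemma tuple_at_vcons Γ σ (a : thread σ) (ρ : valuation thread Γ) m :
  tuple_at (vcons a ρ) m = scons (a m) (tuple_at ρ m).
Proof. exact: vcons_eta. Qed.

Definition tuple_coherent_at Γ (ρ : valuation thread Γ) m : Prop :=
  forall τ x, ρ τ x m.+1 = wk (ρ τ x m).

Lemma tuple_coherent Γ (ρ : valuation thread Γ) :
  \forall m \near \oo, tuple_coherent_at ρ m.
Proof.
elim: Γ ρ => [|σ Γ IHΓ] ρ; first by exists 0 => // m _ τ x; apply: var_nilP x.
apply: filterS2 (thread_coherent (ρ σ vz)) (IHΓ (fun τ x => ρ τ (vs x))).
by move=> m cz cs; apply: var_consP.
Qed.

Lemma sub_tuple_coherent Γ (φ : fm Γ) (ρ : valuation thread Γ) n :
  (forall m, n <= m -> tuple_coherent_at ρ m) ->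
  coherent_from n (fun m => sub_fm φ (tuple_at ρ m)).
Proof.
move=> cρ m /cρ cm; rewrite wk_fm_sub; congr sub_fm.
by apply: valuation_ext => τ x; apply: cm.
Qed.

Definition holds Γ (φ : fm Γ) (ρ : valuation thread Γ) : Prop :=
  \forall m \near \oo, prv T (H_ m) (sub_fm φ (tuple_at ρ m)).

Lemma holds_em Γ (φ : fm Γ) ρ : holds φ ρ \/ holds (Neg φ) ρ.
Proof.
have [n _ cρ] := tuple_coherent ρ.
have cφ := sub_tuple_coherent φ cρ; have cNφ := sub_tuple_coherent (Neg φ) cρ.
have [m le_nm] := coherent_decided cφ.
rewrite /decide; case: pselect => _ /prv_current d.
  by left; apply: (coherent_prv cφ (leqW le_nm)); rewrite (cφ m le_nm).
by right; apply: (coherent_prv cNφ (leqW le_nm)); rewrite (cNφ m le_nm).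
Qed.

Lemma holds_Bot Γ (ρ : valuation thread Γ) : ~ holds Bot ρ.
Proof. by move=> /filter_ex[m /chain_consistent]. Qed.

Lemma holds_Imp Γ (φ ψ : fm Γ) ρ : holds (φ ⊃ ψ) ρ <-> (holds φ ρ -> holds ψ ρ).
Proof.
split=> [|imp]; first by apply: filterS2 => m; apply: prv_impE.
have [/imp|] := holds_em φ ρ; apply: filterS => m d; apply: prv_impI.
  exact: prv_cons d.
exact: prv_contra d.
Qed.

Lemma holds_Neg Γ (φ : fm Γ) ρ : holds (Neg φ) ρ <-> ~ holds φ ρ.
Proof. by rewrite holds_Imp; split=> nφ /nφ // /holds_Bot. Qed.

Lemma holds_And Γ (φ ψ : fm Γ) ρ : holds (φ ⊓ ψ) ρ <-> holds φ ρ /\ holds ψ ρ.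
Proof.
split=> [d|[]]; last by apply: filterS2 => m; apply: prv_andI.
by split; apply: filterS d => m; [apply: prv_andE1|apply: prv_andE2].
Qed.

Lemma holds_Or Γ (φ ψ : fm Γ) ρ : holds (φ ⊔ ψ) ρ <-> holds φ ρ \/ holds ψ ρ.
Proof.
split=> [dor|[]]; last 2 first.
- by apply: filterS => m; apply: prv_orI1.
- by apply: filterS => m; apply: prv_orI2.
have [|nφ] := holds_em φ ρ; first by left.
right; apply: filterS2 dor nφ => m dor nφ; apply: prv_orE dor (prv_contra _ nφ) _.
by apply: prv_hyp; left.
Qed.

Lemma holds_All_inst Γ σ (φ : fm (σ :: Γ)) ρ a : holds (All σ φ) ρ -> holds φ (vcons a ρ).
Proof. by apply: filterS => m d; rewrite tuple_at_vcons -inst_up; apply: prv_allE. Qed.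

Lemma holds_Ex_intro Γ σ (φ : fm (σ :: Γ)) ρ a : holds φ (vcons a ρ) -> holds (Ex σ φ) ρ.
Proof.
apply: filterS => m; rewrite tuple_at_vcons => d.
by apply: (prv_exI (t := a m)); rewrite inst_up.
Qed.

Lemma holds_Ex_witness Γ σ (φ : fm (σ :: Γ)) ρ :
  holds (Ex σ φ) ρ -> exists a, holds φ (vcons a ρ).
Proof.
move=> [n1 _ d]; have [n2 _ cρ] := tuple_coherent ρ.
pose n := maxn n1 n2.
have {}cρ m : n <= m -> tuple_coherent_at ρ m by rewrite geq_max => /andP[_ /cρ].
have [m le_nm] := coherent_decided (sub_tuple_coherent (Ex σ φ) cρ).
have {d}d : prv T (H_ m) (Ex σ (sub_fm φ (up (tuple_at ρ m)))).
  by apply: d; apply: leq_trans (leq_maxl _ _) le_nm.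
rewrite (decide_prv (@chain_consistent m) d) => /witness_in[x xP].
exists (thread_of (m := m.+1) (Var x)).
apply: (@coherent_prv m.+1 _ m.+1) (leqnn _) _.
  apply: sub_tuple_coherent => k lt_mk; apply: var_consP => [|τ y].
    exact: weaken_toS.
  by apply: cρ; apply: leq_trans le_nm (ltnW lt_mk).
rewrite tuple_at_vcons [thread_of _ _]weaken_to_id.
apply: prv_hyp; apply: in_or_app; left; move: xP.
rewrite sub_fm_comp; congr (In (sub_fm _ _) _); apply: vcons_eta => // τ y /=.
by rewrite sub_tm_wk [RHS](cρ m le_nm) /wk ren_tm_sub.
Qed.

Lemma holds_Ex Γ σ (φ : fm (σ :: Γ)) ρ :
  holds (Ex σ φ) ρ <-> exists a, holds φ (vcons a ρ).
Proof. by split=> [/holds_Ex_witness|[a /holds_Ex_intro]]. Qed.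

Lemma holds_All Γ σ (φ : fm (σ :: Γ)) ρ :
  holds (All σ φ) ρ <-> forall a, holds φ (vcons a ρ).
Proof.
split=> [d a|all]; first exact: holds_All_inst.
have : ~ holds (Ex σ (Neg φ)) ρ by move=> /holds_Ex[a /holds_Neg]; apply.
move=> /holds_Neg; apply: filterS => m.
exact: prv_forall_of_not_exists_not.
Qed.

Definition thread_app σ τ (f : thread (σ ⇒ τ)) (a : thread σ) : thread τ.
Proof.
apply: (@Thread τ (fun m => f m ⋅ a m)).
by apply: filterS2 (thread_coherent f) (thread_coherent a) => m -> ->.
Defined.

Definition thread_cst τ (c : cst τ) : thread τ.
Proof. by apply: (@Thread τ (fun m => Cst c)); exists 0. Defined.

Definition henkin : structure := {|
  dom := thread;
  ap := thread_app;
  icst := thread_cst;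
  ieq a b := \forall m \near \oo, prv T (H_ m) (a m ≐ b m) |}.

Lemma eval_henkin Γ τ (t : tm Γ τ) (ρ : env henkin Γ) m :
  at_stage (eval t ρ) m = sub_tm (tuple_at ρ m) t.
Proof. by elim: t => //= ? ? t <- u <-. Qed.

Lemma truth Γ (φ : fm Γ) (ρ : env henkin Γ) : sat φ ρ <-> holds φ ρ.
Proof.
elim: φ ρ => {Γ} /=.
- by move=> Γ t u ρ; split; apply: filterS => m; rewrite /= !eval_henkin.
- by move=> Γ ρ; split=> // /holds_Bot.
- by move=> Γ φ IHφ ψ IHψ ρ; rewrite holds_Imp IHφ IHψ.
- by move=> Γ φ IHφ ψ IHψ ρ; rewrite holds_And IHφ IHψ.
- by move=> Γ φ IHφ ψ IHψ ρ; rewrite holds_Or IHφ IHψ.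
- by move=> Γ σ φ IHφ ρ; rewrite holds_All; split=> all a; exact/IHφ/all.
- by move=> Γ σ φ IHφ ρ; rewrite holds_Ex; split=> -[a /IHφ]; exists a.
Qed.

Lemma henkin_models : models henkin T.
Proof. by move=> Γ φ ρ Tφ; apply/truth; exists 0 => // m _; apply/prv_ax/T_sub. Qed.

Lemma henkin_refutes : ~ sat φ0 (enil henkin).
Proof.
rewrite truth -holds_Neg.
have coherent m : 0 <= m -> tuple_coherent_at (enil henkin) m.
  by move=> _ τ x; apply: var_nilP x.
apply: coherent_prv (sub_tuple_coherent (Neg φ0) coherent) (leqnn 0) _.
rewrite [tuple_at _ _](valuation_nil _ (fun _ x => Var x)) sub_fm_Var.
by apply: prv_hyp; left.
Qed.

End Completeness.

Theorem completeness (T : forall Γ, fm Γ -> Prop) (φ : fm []) :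
  (forall Γ Δ (ψ : fm Γ) (s : sub Γ Δ), T _ ψ -> T _ (sub_fm ψ s)) ->
  (forall M, models M T -> sat φ (enil M)) -> proves T φ.
Proof.
move=> T_sub valid; apply: contrapT => unprovable.
exact: (henkin_refutes T_sub unprovable (valid _ (henkin_models T_sub unprovable))).
Qed.

(** * Extensional models *)

Lemma sub_eqt τ Γ Δ (t u : tm Γ τ) (s : sub Γ Δ) :
  sub_fm (eqt t u) s = eqt (sub_tm s t) (sub_tm s u).
Proof.
elim: τ Γ Δ t u s => [//|σ _ τ IHτ] Γ Δ t u s /=.
by rewrite IHτ /= !sub_tm_up_wk.
Qed.

Lemma qf_sub Γ (φ : fm Γ) Δ (s : sub Γ Δ) : qf φ -> qf (sub_fm φ s).
Proof.
by elim: φ Δ s => {Γ} //= Γ φ IHφ ψ IHψ Δ s [/IHφ ? /IHψ ?].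
Qed.

Lemma RCA0w_sub Γ Δ (φ : fm Γ) (s : sub Γ Δ) : RCA0w φ -> RCA0w (sub_fm φ s).
Proof.
move=> ax; case: ax Δ s => {Γ φ} /=; try by move=> *; rewrite ?sub_eqt; constructor.
move=> Γ φ qfφ Δ s; rewrite sub_inst.
have -> : sub_fm (sub_fm φ (scons (succ v0) (fun _ x => Var (vs x)))) (up s) =
          sub_fm (sub_fm φ (up s)) (scons (succ v0) (fun _ x => Var (vs x))).
  rewrite !sub_fm_comp; congr sub_fm; apply: valuation_ext; apply: var_consP => //= τ x.
  by rewrite sub_tm_wk /= /wk ren_tm_sub.
exact/ax_qfind/qf_sub.
Qed.

Lemma ACA0w_QFAC01_sub Γ Δ (φ : fm Γ) (s : sub Γ Δ) :
  ACA0w_QFAC01 φ -> ACA0w_QFAC01 (sub_fm φ s).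
Proof.
move=> ax; case: ax Δ s => {Γ φ} [Γ φ ax|Γ] Δ s; last exact: ax_qfac01.
apply: ACA0w_QFAC01_base; case: ax Δ s => {Γ φ} [Γ φ ax|Γ] Δ s; last exact: ax_exists2.
exact/ACA0w_base/RCA0w_sub.
Qed.

Lemma eval_ren M Γ Δ (r : ren Γ Δ) (ρ : env M Δ) τ (t : tm Γ τ) :
  eval (ren_tm r t) ρ = eval t (fun τ x => ρ τ (r τ x)).
Proof. by elim: t => //= ? ? t -> u ->. Qed.

Lemma eval_wk M Γ σ (a : dom M σ) (ρ : env M Γ) τ (t : tm Γ τ) :
  eval (wk t) (econs a ρ) = eval t ρ.
Proof. exact: eval_ren. Qed.

Lemma eval_sub M Γ Δ (s : sub Γ Δ) (ρ : env M Δ) τ (t : tm Γ τ) :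
  eval (sub_tm s t) ρ = eval t (fun τ x => eval (s τ x) ρ).
Proof. by elim: t => //= ? ? t -> u ->. Qed.

Lemma eval_up M Γ Δ (s : sub Γ Δ) σ (a : dom M σ) (ρ : env M Δ) :
  (fun τ x => eval (up s τ x) (econs a ρ)) = econs a (fun τ x => eval (s τ x) ρ).
Proof. by apply: vcons_eta => // τ x; exact: eval_wk. Qed.

Lemma sat_sub M Γ (φ : fm Γ) Δ (s : sub Γ Δ) (ρ : env M Δ) :
  sat (sub_fm φ s) ρ <-> sat φ (fun τ x => eval (s τ x) ρ).
Proof.
elim: φ Δ s ρ => {Γ} //=.
- by move=> Γ t u Δ s ρ; rewrite !eval_sub.
1-3: by move=> Γ φ IHφ ψ IHψ Δ s ρ; rewrite IHφ IHψ.
- by move=> Γ σ φ IHφ Δ s ρ; split=> + a => /(_ a); rewrite IHφ eval_up.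
- by move=> Γ σ φ IHφ Δ s ρ; split=> -[a φa]; exists a; move: φa; rewrite IHφ eval_up.
Qed.

Lemma sat_wk_fm M Γ σ (φ : fm Γ) (a : dom M σ) (ρ : env M Γ) :
  sat (wk_fm φ) (econs a ρ) <-> sat φ ρ.
Proof. exact: sat_sub. Qed.

Fixpoint eqv M τ : dom M τ -> dom M τ -> Prop :=
  match τ with
  | N => fun a b => ieq a b
  | Arr σ τ => fun f g => forall a, eqv (ap f a) (ap g a)
  end.

Lemma sat_eqt M τ Γ (t u : tm Γ τ) (ρ : env M Γ) :
  sat (eqt t u) ρ <-> eqv (eval t ρ) (eval u ρ).
Proof.
elim: τ Γ t u ρ => [//|σ _ τ IHτ] Γ t u ρ /=.
by split=> tu a; have := tu a; rewrite IHτ /= !eval_wk.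
Qed.

Section Quotient.
Local Open Scope quotient_scope.
Variable M : structure.
Hypothesis M_RCA0w : models M RCA0w.

Lemma eqv_refl τ (a : dom M τ) : eqv a a.
Proof.
elim: τ a => [|σ _ τ IHτ] a; last by move=> b; apply: IHτ.
exact: (M_RCA0w (enil M) (ax_refl [])).
Qed.

Lemma eqv_sym τ (a b : dom M τ) : eqv a b -> eqv b a.
Proof.
elim: τ a b => [|σ _ τ IHτ] a b; last by move=> ab c; apply: IHτ.
exact: (M_RCA0w (enil M) (ax_sym [])).
Qed.

Lemma eqv_trans τ (a b c : dom M τ) : eqv a b -> eqv b c -> eqv a c.
Proof.
elim: τ a b c => [|σ _ τ IHτ] a b c; last by move=> ab bc d; apply: IHτ (ab d) (bc d).
exact: (M_RCA0w (enil M) (ax_trans [])).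
Qed.

Lemma eqv_ap σ τ (f g : dom M (σ ⇒ τ)) (a b : dom M σ) :
  eqv f g -> eqv a b -> eqv (ap f a) (ap g b).
Proof.
move=> fg ab; apply: eqv_trans (fg a) _.
pose ρ : env M [σ ⇒ τ; σ; σ] := econs g (econs b (econs a (enil M))).
have : sat (eqt v2 v1) ρ -> sat (eqt (v0 ⋅ v2) (v0 ⋅ v1)) ρ.
  exact: (M_RCA0w (enil M) (ax_ext [] σ τ) a b g).
by rewrite !sat_eqt; apply.
Qed.

Definition eqv_rel τ : rel {classic dom M τ} := fun a b => `[< eqv a b >].

Lemma eqv_rel_refl τ : reflexive (@eqv_rel τ).
Proof. by move=> a; apply/asboolP/eqv_refl. Qed.

Lemma eqv_rel_sym τ : symmetric (@eqv_rel τ).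
Proof. by move=> a b; apply/asboolP/asboolP; apply: eqv_sym. Qed.

Lemma eqv_rel_trans τ : transitive (@eqv_rel τ).
Proof. by move=> b a c /asboolP ab /asboolP bc; apply/asboolP/(eqv_trans ab). Qed.

Canonical eqv_equiv τ :=
  EquivRel (@eqv_rel τ) (@eqv_rel_refl τ) (@eqv_rel_sym τ) (@eqv_rel_trans τ).

Definition class_of τ (a : dom M τ) : {eq_quot @eqv_rel τ} := \pi a.

Lemma class_ofP τ (a b : dom M τ) : class_of a = class_of b <-> eqv a b.
Proof. by split=> [/eqmodP/asboolP|ab]; last exact/eqmodP/asboolP. Qed.

Lemma class_of_repr τ (c : {eq_quot @eqv_rel τ}) : class_of (repr c) = c.
Proof. exact: reprK. Qed.

Definition quotient : structure := {|
  dom τ := {eq_quot @eqv_rel τ};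
  ap σ τ f a := class_of (ap (repr f : dom M (σ ⇒ τ)) (repr a));
  icst τ c := class_of (icst M c);
  ieq := eq |}.

Lemma ap_class_of σ τ (f : dom M (σ ⇒ τ)) a :
  ap (s := quotient) (class_of f) (class_of a) = class_of (ap f a).
Proof. by apply/class_ofP/eqv_ap; apply/class_ofP; exact: class_of_repr. Qed.

Definition class_env Γ (ρ : env M Γ) : env quotient Γ := fun τ x => class_of (ρ τ x).

Lemma class_env_surj Γ (ρ : env quotient Γ) : exists ρ', ρ = class_env ρ'.
Proof.
exists (fun τ x => repr (ρ τ x)); apply: valuation_ext => τ x.
by rewrite -[LHS]class_of_repr.
Qed.

Lemma econs_class_of Γ σ (a : dom M σ) (ρ : env M Γ) :
  econs (M := quotient) (class_of a) (class_env ρ) = class_env (econs a ρ).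
Proof. exact/esym/vcons_eta. Qed.

Lemma eval_quotient Γ τ (t : tm Γ τ) (ρ : env M Γ) :
  eval t (class_env ρ) = class_of (eval t ρ).
Proof.
elim: t => // σ τ' t IHt u IHu.
by rewrite -[LHS]/(ap (eval t _) (eval u _)) IHt IHu ap_class_of.
Qed.

Lemma sat_quotient Γ (φ : fm Γ) (ρ : env M Γ) : sat φ (class_env ρ) <-> sat φ ρ.
Proof.
elim: φ ρ => {Γ} //.
- by move=> Γ t u ρ; rewrite -[sat _ ρ]class_ofP -!eval_quotient.
1-3: by move=> Γ φ IHφ ψ IHψ ρ /=; rewrite IHφ IHψ.
- move=> Γ σ φ IHφ ρ; split=> all a.
    by apply/IHφ; rewrite -econs_class_of; apply: all.
  by rewrite -(class_of_repr a) econs_class_of; apply/IHφ.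
- move=> Γ σ φ IHφ ρ; split=> -[a φa].
    by exists (repr a); apply/IHφ; rewrite -econs_class_of class_of_repr.
  by exists (class_of a); rewrite econs_class_of; apply/IHφ.
Qed.

Lemma quotient_models T : models M T -> models quotient T.
Proof.
by move=> MT Γ φ ρ /MT; have [ρ' ->] := class_env_surj ρ => Mφ; apply/sat_quotient.
Qed.

Lemma quotient_ext σ τ (f g : dom quotient (σ ⇒ τ)) :
  (forall a, ap f a = ap g a) -> f = g.
Proof.
rewrite -(class_of_repr f) -(class_of_repr g) => fg; apply/class_ofP => a.
by apply/class_ofP; rewrite -!ap_class_of.
Qed.

End Quotient.

Record model := Model {
  mdom : ty -> Type;
  mapp : forall σ τ, mdom (σ ⇒ τ) -> mdom σ -> mdom τ;
  mcst : forall τ, cst τ -> mdom τ;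
  model_RCA0w : models (@Structure mdom mapp mcst eq) RCA0w;
  model_ext : forall σ τ (f g : mdom (σ ⇒ τ)),
    (forall a, mapp f a = mapp g a) -> f = g }.

Coercion structure_of_model (M : model) : structure :=
  @Structure (mdom M) (@mapp M) (@mcst M) eq.

Arguments dom : simpl never.
Arguments ap : simpl never.
Arguments icst : simpl never.

Theorem extensional_completeness (T : forall Γ, fm Γ -> Prop) (φ : fm []) :
  (forall Γ Δ (ψ : fm Γ) (s : sub Γ Δ), T _ ψ -> T _ (sub_fm ψ s)) ->
  (forall Γ (ψ : fm Γ), RCA0w ψ -> T _ ψ) ->
  (forall M : model, models M T -> sat φ (enil M)) ->
  proves T φ.
Proof.
move=> T_sub T_RCA0w valid; apply: (completeness T_sub) => M MT.
have M_RCA0w : models M RCA0w by move=> Γ ψ ρ /T_RCA0w; apply: MT.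
apply/(sat_quotient M_RCA0w); rewrite [class_env _ _](valuation_nil _ (enil _)).
pose Q := Model (@quotient_models M M_RCA0w RCA0w M_RCA0w) (@quotient_ext M M_RCA0w).
exact: (valid Q (@quotient_models M M_RCA0w T MT)).
Qed.

(** * The ordered field of fractions of a cancellative semiring *)

Section OrderedField.
Import Order.TTheory GRing.Theory Num.Theory.
Local Open Scope ring_scope.

Section PositiveCone.
Variables (R : idomainType) (cone : pred R).
Hypothesis coneD : forall x y, cone x -> cone y -> cone (x + y).
Hypothesis coneM : forall x y, cone x -> cone y -> cone (x * y).
Hypothesis cone_anti : forall x, cone x -> cone (- x) -> x = 0.
Hypothesis cone_total : forall x, cone x || cone (- x).

Definition cone_le (x y : R) : bool := cone (y - x).
Definition cone_lt (x y : R) : bool := (y != x) && cone_le x y.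
Definition cone_norm (x : R) : R := if cone x then x else - x.

Lemma cone_le0D x y : cone_le 0 x -> cone_le 0 y -> cone_le 0 (x + y).
Proof. by rewrite /cone_le !subr0; apply: coneD. Qed.

Lemma cone_le0M x y : cone_le 0 x -> cone_le 0 y -> cone_le 0 (x * y).
Proof. by rewrite /cone_le !subr0; apply: coneM. Qed.

Lemma cone_le0_anti x : cone_le 0 x -> cone_le x 0 -> x = 0.
Proof. by rewrite /cone_le subr0 sub0r; apply: cone_anti. Qed.

Lemma cone_sub_ge0 x y : cone_le 0 (y - x) = cone_le x y.
Proof. by rewrite /cone_le subr0. Qed.

Lemma cone_le0_total x : cone_le 0 x || cone_le x 0.
Proof. by rewrite /cone_le subr0 sub0r. Qed.

Lemma cone_normN x : cone_norm (- x) = cone_norm x.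
Proof.
rewrite /cone_norm opprK; have := cone_total x; have := @cone_anti x.
by case: (cone x); case: (cone (- x)) => // -> //; rewrite oppr0.
Qed.

Lemma ge0_cone_norm x : cone_le 0 x -> cone_norm x = x.
Proof. by rewrite /cone_le /cone_norm subr0 => ->. Qed.

End PositiveCone.

Section Fractions.
Variable R : realDomainType.
Local Notation "x %:F" := (@FracField.tofrac R x).
Implicit Types (x y : {fraction R}) (a b c d : R).

Lemma fraction_numden x : x = (\n_(repr x))%:F / (\d_(repr x))%:F.
Proof.
have den_neq0 : (\d_(repr x))%:F != 0 by rewrite tofrac_eq0 denom_ratioP.
apply: (mulIf den_neq0); rewrite divfK // -{1}(reprK x).
unlock FracField.tofrac; rewrite -[LHS]FracField.pi_mul; apply/eqmodP => /=.
rewrite /FracField.mulf FracField.equivfE.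
rewrite !numden_Ratio ?mulf_neq0 ?oner_eq0 ?denom_ratioP //.
by apply/eqP; ring.
Qed.

Definition frac_nonneg x : bool := 0 <= \n_(repr x) * \d_(repr x).

Lemma frac_nonneg_div a b : b != 0 -> frac_nonneg (a%:F / b%:F) = (0 <= a * b).
Proof.
move=> b0; rewrite /frac_nonneg.
have := fraction_numden (a%:F / b%:F); have := denom_ratioP (repr (a%:F / b%:F)).
move: (\n_(repr _)) (\d_(repr _)) => n d d0 /eqP.
rewrite eqr_div ?tofrac_eq0 // -!tofracM tofrac_eq => /eqP ad.
have b2_gt0 : 0 < b ^+ 2 by rewrite exprn_even_gt0.
have d2_gt0 : 0 < d ^+ 2 by rewrite exprn_even_gt0.
rewrite -(pmulr_lge0 (n * d) b2_gt0) -(pmulr_lge0 (a * b) d2_gt0); congr (0 <= _).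
have -> : n * d * b ^+ 2 = (n * b) * (b * d) by ring.
by rewrite -ad; ring.
Qed.

Variant frac_spec : {fraction R} -> Type :=
  FracSpec a b of b != 0 : frac_spec (a%:F / b%:F).

Lemma fracP x : frac_spec x.
Proof. by rewrite [x]fraction_numden; exact/FracSpec/denom_ratioP. Qed.

Lemma frac_nonnegD x y : frac_nonneg x -> frac_nonneg y -> frac_nonneg (x + y).
Proof.
case: (fracP x) (fracP y) => a b b0 [c d d0].
rewrite addf_div ?tofrac_eq0 // -!tofracM -tofracD.
rewrite !frac_nonneg_div ?mulf_neq0 // => ab cd.
have -> : (a * d + c * b) * (b * d) = a * b * d ^+ 2 + c * d * b ^+ 2 by ring.
by rewrite addr_ge0 // mulr_ge0 // sqr_ge0.
Qed.

Lemma frac_nonnegM x y : frac_nonneg x -> frac_nonneg y -> frac_nonneg (x * y).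
Proof.
case: (fracP x) (fracP y) => a b b0 [c d d0].
rewrite mulf_div -!tofracM !frac_nonneg_div ?mulf_neq0 // => ab cd.
by rewrite mulrACA mulr_ge0.
Qed.

Lemma frac_nonneg_anti x : frac_nonneg x -> frac_nonneg (- x) -> x = 0.
Proof.
case: (fracP x) => a b b0; rewrite -mulNr -tofracN !frac_nonneg_div // mulNr oppr_ge0.
move=> ab_ge0 ab_le0; have : a * b == 0 by rewrite eq_le ab_le0.
by rewrite mulf_eq0 (negPf b0) orbF => /eqP ->; rewrite tofrac0 mul0r.
Qed.

Lemma frac_nonneg_total x : frac_nonneg x || frac_nonneg (- x).
Proof.
case: (fracP x) => a b b0; rewrite -mulNr -tofracN !frac_nonneg_div // mulNr oppr_ge0.
exact: le_total.
Qed.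

Definition fraction_isLeReal := Num.IntegralDomain_isLeReal.Build {fraction R}
  (cone_le0D frac_nonnegD) (cone_le0M frac_nonnegM) (cone_le0_anti frac_nonneg_anti)
  (cone_sub_ge0 frac_nonneg) (cone_le0_total frac_nonneg_total)
  (cone_normN frac_nonneg_anti frac_nonneg_total) (@ge0_cone_norm _ frac_nonneg)
  (fun x y => erefl (cone_lt frac_nonneg x y)).

Lemma realDomain_field_embedding :
  exists (F : realFieldType) (f : {rmorphism R -> F}), {mono f : x y / x <= y}.
Proof.
pose F : realFieldType := HB.pack {fraction R} fraction_isLeReal.
exists F, (@FracField.tofrac R : {rmorphism R -> F}) => a b.
rewrite -[LHS]/(frac_nonneg (b%:F - a%:F)) -tofracB -[X in frac_nonneg X]divr1.
by rewrite -tofrac1 frac_nonneg_div ?oner_neq0 // mulr1 subr_ge0.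
Qed.

End Fractions.

Section Differences.
Local Open Scope quotient_scope.
Variable A : comNzSemiRingType.
Hypothesis addIA : left_injective (@GRing.add A).
Hypothesis totalA : forall a b : A, exists c, a + c = b \/ b + c = a.
Hypothesis addA_eq0 : forall a b : A, a + b = 0 -> a = 0.
Hypothesis mulA_eq0 : forall a b : A, a * b = 0 -> a = 0 \/ b = 0.

Definition difrel (p q : A * A) : bool := p.1 + q.2 == q.1 + p.2.

Lemma difrel_refl : reflexive difrel.
Proof. by move=> p; apply/eqP. Qed.

Lemma difrel_sym : symmetric difrel.
Proof. by move=> p q; rewrite /difrel eq_sym. Qed.

Lemma difrel_trans : transitive difrel.
Proof.
move=> [c d] [a b] [e f] /eqP/= ad_cb /eqP/= cf_ed; apply/eqP/(@addIA d) => /=.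
have -> : a + f + d = (a + d) + f by ring.
by rewrite ad_cb addrAC cf_ed; ring.
Qed.

Canonical difrel_equiv := EquivRel difrel difrel_refl difrel_sym difrel_trans.

Definition dif := {eq_quot difrel}.
HB.instance Definition _ : EqQuotient _ difrel dif := EqQuotient.on dif.
HB.instance Definition _ := Choice.on dif.

Lemma dif_eqP (p q : A * A) : \pi_dif p = \pi_dif q <-> p.1 + q.2 = q.1 + p.2.
Proof. by split=> [/eqmodP/eqP|pq]; last by apply/eqmodP/eqP. Qed.

Lemma dif_reprP (p : A * A) :
  p.1 + (repr (\pi_dif p)).2 = (repr (\pi_dif p)).1 + p.2.
Proof. by apply/dif_eqP; rewrite reprK. Qed.

Definition dif_of (a : A) : dif := \pi_dif (a, 0).

Definition dif_add (x y : dif) : dif :=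
  \pi_dif ((repr x).1 + (repr y).1, (repr x).2 + (repr y).2).

Definition dif_opp (x : dif) : dif := \pi_dif ((repr x).2, (repr x).1).

Definition dif_mul (x y : dif) : dif :=
  \pi_dif ((repr x).1 * (repr y).1 + (repr x).2 * (repr y).2,
           (repr x).1 * (repr y).2 + (repr x).2 * (repr y).1).

Lemma pi_dif_add p q :
  dif_add (\pi_dif p) (\pi_dif q) = \pi_dif (p.1 + q.1, p.2 + q.2).
Proof.
rewrite /dif_add; apply/dif_eqP; have := dif_reprP p; have := dif_reprP q.
move: (repr (\pi_dif p)) (repr (\pi_dif q)) => p' q' qq' pp' /=.
have -> : p'.1 + q'.1 + (p.2 + q.2) = (p'.1 + p.2) + (q'.1 + q.2) by ring.
by rewrite -pp' -qq'; ring.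
Qed.

Lemma pi_dif_opp p : dif_opp (\pi_dif p) = \pi_dif (p.2, p.1).
Proof. by apply/dif_eqP; rewrite /= addrC (dif_reprP p) addrC. Qed.

Lemma pi_dif_mul p q :
  dif_mul (\pi_dif p) (\pi_dif q) =
  \pi_dif (p.1 * q.1 + p.2 * q.2, p.1 * q.2 + p.2 * q.1).
Proof.
have := dif_reprP p; have := dif_reprP q; rewrite /dif_mul.
move: (repr (\pi_dif p)) (repr (\pi_dif q)) => q' p' pp' qq'.
transitivity (\pi_dif (p.1 * p'.1 + p.2 * p'.2, p.1 * p'.2 + p.2 * p'.1)).
  apply/dif_eqP => /=.
  have -> : q'.1 * p'.1 + q'.2 * p'.2 + (p.1 * p'.2 + p.2 * p'.1) =
    (q'.1 + p.2) * p'.1 + (p.1 + q'.2) * p'.2 by ring.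
  by rewrite -qq' {2}qq'; ring.
apply/dif_eqP => /=.
have -> : p.1 * p'.1 + p.2 * p'.2 + (p.1 * q.2 + p.2 * q.1) =
  p.1 * (p'.1 + q.2) + p.2 * (q.1 + p'.2) by ring.
by rewrite -pp' {2}pp'; ring.
Qed.

Lemma dif_addA : associative dif_add.
Proof.
elim/quotW=> x; elim/quotW=> y; elim/quotW=> z.
rewrite (pi_dif_add y z) (pi_dif_add x) (pi_dif_add x y) (pi_dif_add _ z) /=.
by rewrite !addrA.
Qed.

Lemma dif_addC : commutative dif_add.
Proof. by elim/quotW=> x; elim/quotW=> y; rewrite !pi_dif_add addrC (addrC x.2). Qed.

Lemma dif_add0 : left_id (dif_of 0) dif_add.
Proof. by elim/quotW=> -[a b]; rewrite pi_dif_add /= !add0r. Qed.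

Lemma dif_addN : left_inverse (dif_of 0) dif_opp dif_add.
Proof.
elim/quotW=> x; rewrite pi_dif_opp pi_dif_add; apply/dif_eqP => /=.
by rewrite addr0 add0r addrC.
Qed.

HB.instance Definition _ :=
  GRing.isZmodule.Build dif dif_addA dif_addC dif_add0 dif_addN.

Lemma dif_mulA : associative dif_mul.
Proof.
elim/quotW=> x; elim/quotW=> y; elim/quotW=> z.
rewrite (pi_dif_mul y z) (pi_dif_mul x) (pi_dif_mul x y) (pi_dif_mul _ z) /=.
by apply: (congr1 \pi_dif); congr pair; ring.
Qed.

Lemma dif_mulC : commutative dif_mul.
Proof.
elim/quotW=> x; elim/quotW=> y.
by rewrite !pi_dif_mul /=; apply: (congr1 \pi_dif); congr pair; ring.
Qed.

Lemma dif_mul1 : left_id (dif_of 1) dif_mul.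
Proof. by elim/quotW=> -[a b]; rewrite pi_dif_mul /= !mul1r !mul0r !addr0. Qed.

Lemma dif_mulD : left_distributive dif_mul dif_add.
Proof.
elim/quotW=> x; elim/quotW=> y; elim/quotW=> z.
rewrite (pi_dif_add x y) (pi_dif_mul _ z) (pi_dif_mul x z) (pi_dif_mul y z).
by rewrite pi_dif_add; apply: (congr1 \pi_dif); congr pair; rewrite /=; ring.
Qed.

Lemma dif_of_inj : injective dif_of.
Proof. by move=> a b /dif_eqP /=; rewrite !addr0. Qed.

Lemma dif_of1_neq0 : dif_of 1 != dif_of 0.
Proof. by rewrite (inj_eq dif_of_inj) oner_eq0. Qed.

HB.instance Definition _ :=
  GRing.Zmodule_isComNzRing.Build dif dif_mulA dif_mulC dif_mul1 dif_mulD dif_of1_neq0.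

Lemma dif_of_nmod_morphism : nmod_morphism dif_of.
Proof. by split=> // a b; rewrite [RHS]pi_dif_add /= addr0. Qed.

Lemma dif_of_monoid_morphism : monoid_morphism dif_of.
Proof. by split=> // a b; rewrite [RHS]pi_dif_mul /= !mulr0 mul0r !addr0. Qed.

HB.instance Definition _ :=
  GRing.isNmodMorphism.Build A dif dif_of dif_of_nmod_morphism.
HB.instance Definition _ :=
  GRing.isMonoidMorphism.Build A dif dif_of dif_of_monoid_morphism.

Definition dif_unit : {pred dif} := fun x => `[< exists y, y * x = 1 >].
Definition dif_inv (x : dif) : dif :=
  if pselect (exists y, y * x = 1) is left h then sval (cid h) else x.

Lemma dif_mulV : {in dif_unit, left_inverse 1 dif_inv *%R}.
Proof. by move=> x /asboolP h; rewrite /dif_inv; case: pselect => // h'; case: cid. Qed.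

Lemma dif_unitP (x y : dif) : y * x = 1 -> dif_unit x.
Proof. by move=> yx; apply/asboolP; exists y. Qed.

Lemma dif_inv_out : {in [predC dif_unit], dif_inv =1 id}.
Proof. by move=> x /asboolP h; rewrite /dif_inv; case: pselect. Qed.

HB.instance Definition _ :=
  GRing.ComNzRing_hasMulInverse.Build dif dif_mulV dif_unitP dif_inv_out.

Lemma difP (x : dif) : exists a, x = dif_of a \/ x = - dif_of a.
Proof.
elim/quotW: x => -[a b]; have [c [<-|<-]] := totalA a b; exists c.
  by right; rewrite [RHS]pi_dif_opp; apply/dif_eqP => /=; rewrite add0r.
by left; apply/dif_eqP => /=; rewrite addr0 addrC.
Qed.

Lemma dif_integral (x y : dif) : x * y = 0 -> (x == 0) || (y == 0).
Proof.
have [a ax] := difP x; have [b bY] := difP y => xy0.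
have : dif_of (a * b) = dif_of 0.
  rewrite rmorphM rmorph0; case: ax bY xy0 => -> [] ->; rewrite ?mulNr ?mulrN ?opprK //.
    by move/eqP; rewrite oppr_eq0 => /eqP.
  by move/eqP; rewrite oppr_eq0 => /eqP.
move=> /dif_of_inj/mulA_eq0[] e0; apply/orP; [left|right].
  by case: ax => ->; rewrite e0 rmorph0 ?oppr0.
by case: bY => ->; rewrite e0 rmorph0 ?oppr0.
Qed.

HB.instance Definition _ := GRing.ComUnitRing_isIntegral.Build dif dif_integral.

Definition dif_nonneg (x : dif) : bool := `[< exists a, x = dif_of a >].

Lemma dif_nonnegD x y : dif_nonneg x -> dif_nonneg y -> dif_nonneg (x + y).
Proof.
by move=> /asboolP[a ->] /asboolP[b ->]; apply/asboolP; exists (a + b); rewrite rmorphD.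
Qed.

Lemma dif_nonnegM x y : dif_nonneg x -> dif_nonneg y -> dif_nonneg (x * y).
Proof.
by move=> /asboolP[a ->] /asboolP[b ->]; apply/asboolP; exists (a * b); rewrite rmorphM.
Qed.

Lemma dif_nonneg_anti x : dif_nonneg x -> dif_nonneg (- x) -> x = 0.
Proof.
move=> /asboolP[a ->] /asboolP[b ab]; have : dif_of (a + b) = dif_of 0.
  by rewrite rmorphD /= -ab subrr rmorph0.
by move=> /dif_of_inj/addA_eq0 ->; rewrite rmorph0.
Qed.

Lemma dif_nonneg_total x : dif_nonneg x || dif_nonneg (- x).
Proof.
by have [a [->|->]] := difP x; apply/orP; [left|right]; apply/asboolP; exists a;
  rewrite ?opprK.
Qed.

Definition dif_isLeReal := Num.IntegralDomain_isLeReal.Build dif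
  (cone_le0D dif_nonnegD) (cone_le0M dif_nonnegM) (cone_le0_anti dif_nonneg_anti)
  (cone_sub_ge0 dif_nonneg) (cone_le0_total dif_nonneg_total)
  (cone_normN dif_nonneg_anti dif_nonneg_total) (@ge0_cone_norm _ dif_nonneg)
  (fun x y => erefl (cone_lt dif_nonneg x y)).

Lemma semiring_field_embedding :
  exists (F : realFieldType) (f : {rmorphism A -> F}), injective f /\ forall a, 0 <= f a.
Proof.
pose D : realDomainType := HB.pack dif dif_isLeReal.
have [F [f f_le]] := realDomain_field_embedding D.
exists F, (f \o (dif_of : {rmorphism A -> D}) : {rmorphism A -> F}); split.
  exact: inj_comp (inc_inj f_le) dif_of_inj.
move=> a; rewrite /= -(rmorph0 f) f_le -[_ <= _]/(dif_nonneg (dif_of a - 0)) subr0.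
by apply/asboolP; exists a.
Qed.

End Differences.
End OrderedField.

(** * The semiring of numbers of a model *)

Local Notation "f ∙ a" := (ap f a) (at level 40, left associativity).
Local Notation "[ 'env' a ; .. ; b ]" := (econs a .. (econs b (enil _)) ..)
  (format "[ 'env'  a ;  .. ;  b ]").

Definition num (M : model) : Type := dom M N.

Section Numbers.
Variable M : model.
Implicit Types m n p : num M.

Lemma ap_ext σ τ (f g : dom M (σ ⇒ τ)) : (forall a, f ∙ a = g ∙ a) -> f = g.
Proof. exact: model_ext. Qed.

Lemma eqv_eq τ (a b : dom M τ) : eqv a b <-> a = b.
Proof.
elim: τ a b => [//|σ _ τ IHτ] f g; split=> [fg|-> a]; last exact/IHτ.
by apply: ap_ext => a; exact/IHτ/fg.
Qed.

Lemma ap_cK σ τ (a : dom M σ) (b : dom M τ) : icst M (cK σ τ) ∙ a ∙ b = a.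
Proof.
have : sat (eqt (Cst (cK σ τ) ⋅ v1 ⋅ v0) v1) [env b; a].
  exact: (model_RCA0w (enil M) (ax_K [] σ τ) a b).
by rewrite sat_eqt eqv_eq.
Qed.

Lemma ap_cS ρ σ τ (f : dom M (ρ ⇒ σ ⇒ τ)) (g : dom M (ρ ⇒ σ)) (a : dom M ρ) :
  icst M (cS ρ σ τ) ∙ f ∙ g ∙ a = f ∙ a ∙ (g ∙ a).
Proof.
have : sat (eqt (Cst (cS ρ σ τ) ⋅ v2 ⋅ v1 ⋅ v0) (v2 ⋅ v0 ⋅ (v1 ⋅ v0))) [env a; g; f].
  exact: (model_RCA0w (enil M) (ax_S [] ρ σ τ) f g a).
by rewrite sat_eqt eqv_eq.
Qed.

Lemma eval_lam Γ σ τ (t : tm (σ :: Γ) τ) (ρ : env M Γ) (a : dom M σ) :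
  eval (lam t) ρ ∙ a = eval t (econs a ρ).
Proof.
elim: t => [τ' x|τ' c|σ' τ' t IHt u IHu]; last by rewrite /= ap_cS IHt IHu.
  move: τ' x; apply: var_consP => [|τ' x] /=; first by rewrite ap_cS ap_cK.
  exact: ap_cK.
exact: ap_cK.
Qed.

Definition num0 : num M := icst M cZero.
Definition numS n : num M := icst M cSucc ∙ n.
Definition num1 : num M := numS num0.
Definition num_add m n : num M := eval (addN v0 v1) [env m; n].
Definition num_mul m n : num M := eval (mulN v0 v1) [env m; n].
Definition num_pred n : num M := eval (predN v0) [env n].
Definition num_sub m n : num M := eval (monus v0 v1) [env m; n].

Lemma eval_vz Γ (n : num M) (ρ : env M Γ) : eval v0 (econs n ρ) = n.
Proof. by []. Qed.

Lemma eval_vs Γ σ (a : dom M σ) (x : var Γ N) (ρ : env M Γ) :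
  eval (Var (vs x)) (econs a ρ) = eval (Var x) ρ.
Proof. by []. Qed.

Lemma eval_num0 Γ (ρ : env M Γ) : eval zero ρ = num0.
Proof. by []. Qed.

Lemma eval_numS Γ t (ρ : env M Γ) : eval (succ t) ρ = numS (eval t ρ).
Proof. by []. Qed.

Lemma eval_num_add Γ t u (ρ : env M Γ) :
  eval (addN t u) ρ = num_add (eval t ρ) (eval u ρ).
Proof. by []. Qed.

Lemma eval_num_mul Γ t u (ρ : env M Γ) :
  eval (mulN t u) ρ = num_mul (eval t ρ) (eval u ρ).
Proof. by []. Qed.

Lemma eval_num_pred Γ t (ρ : env M Γ) : eval (predN t) ρ = num_pred (eval t ρ).
Proof. by []. Qed.

Lemma eval_num_sub Γ t u (ρ : env M Γ) :
  eval (monus t u) ρ = num_sub (eval t ρ) (eval u ρ).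
Proof. by []. Qed.

Definition eval_numE := (eval_vz, eval_vs, eval_num0, eval_numS, eval_num_add,
  eval_num_mul, eval_num_pred, eval_num_sub).

Lemma rec_0 (f : dom M (N ⇒ N ⇒ N)) a : icst M cRec ∙ f ∙ a ∙ num0 = a.
Proof. exact: (model_RCA0w (enil M) (ax_rec0 []) f a). Qed.

Lemma rec_S (f : dom M (N ⇒ N ⇒ N)) a n :
  icst M cRec ∙ f ∙ a ∙ numS n = f ∙ n ∙ (icst M cRec ∙ f ∙ a ∙ n).
Proof. exact: (model_RCA0w (enil M) (ax_recS []) f a n). Qed.

Lemma numS_neq0 n : numS n <> num0.
Proof. exact: (model_RCA0w (enil M) (ax_succ_neq0 []) n). Qed.

Lemma num_add0 m : num_add m num0 = m.
Proof. exact: rec_0. Qed.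

Lemma num_addS m n : num_add m (numS n) = numS (num_add m n).
Proof. by rewrite /num_add /= rec_S ap_cK. Qed.

Lemma num_mul0 m : num_mul m num0 = num0.
Proof. exact: rec_0. Qed.

Lemma num_mulS m n : num_mul m (numS n) = num_add m (num_mul m n).
Proof. by rewrite /num_mul /= rec_S ap_cK. Qed.

Lemma num_pred0 : num_pred num0 = num0.
Proof. exact: rec_0. Qed.

Lemma num_predS n : num_pred (numS n) = n.
Proof. by rewrite /num_pred /= rec_S ap_cK. Qed.

Lemma num_sub0 m : num_sub m num0 = m.
Proof. exact: rec_0. Qed.

Lemma num_subS m n : num_sub m (numS n) = num_pred (num_sub m n).
Proof. by rewrite /num_sub /= rec_S ap_cK. Qed.

Lemma qf_induction_numS Γ (φ : fm (N :: Γ)) (ρ : env M Γ) : qf φ ->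
  sat φ (econs num0 ρ) ->
  (forall n, sat φ (econs n ρ) -> sat φ (econs (numS n) ρ)) ->
  forall n, sat φ (econs n ρ).
Proof.
move=> qfφ base step; have ind : sat _ ρ := model_RCA0w ρ (ax_qfind qfφ).
apply: ind; split.
  by apply/sat_sub; congr (sat _ _): base; apply/esym/vcons_eta.
by move=> n /step φSn; apply/sat_sub; congr (sat _ _): φSn; apply/esym/vcons_eta.
Qed.

Lemma eqn_induction_numS Γ (t u : tm (N :: Γ) N) (ρ : env M Γ) :
  eval t (econs num0 ρ) = eval u (econs num0 ρ) ->
  (forall n, eval t (econs n ρ) = eval u (econs n ρ) ->
     eval t (econs (numS n) ρ) = eval u (econs (numS n) ρ)) ->
  forall n, eval t (econs n ρ) = eval u (econs n ρ).
Proof. exact: (qf_induction_numS (φ := t ≐ u)). Qed.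

Lemma num_0add n : num_add num0 n = n.
Proof.
apply: (eqn_induction_numS (t := addN zero v0) (u := v0) (ρ := enil M)) => [|k].
  by rewrite !eval_numE num_add0.
by rewrite !eval_numE num_addS => ->.
Qed.

Lemma num_addSl m n : num_add (numS m) n = numS (num_add m n).
Proof.
apply: (eqn_induction_numS (t := addN (succ v1) v0) (u := succ (addN v1 v0))
  (ρ := [env m])) => [|k]; first by rewrite !eval_numE !num_add0.
by rewrite !eval_numE !num_addS => ->.
Qed.

Lemma num_addC : commutative num_add.
Proof.
move=> m; apply: (eqn_induction_numS (t := addN v1 v0) (u := addN v0 v1)
  (ρ := [env m])) => [|k].
  by rewrite !eval_numE num_add0 num_0add.
by rewrite !eval_numE num_addS num_addSl => ->.
Qed.

Lemma num_addA : associative num_add.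
Proof.
move=> m n; apply: (eqn_induction_numS (t := addN v1 (addN v2 v0))
  (u := addN (addN v1 v2) v0) (ρ := [env m; n])) => [|k].
  by rewrite !eval_numE !num_add0.
by rewrite !eval_numE !num_addS => ->.
Qed.

Lemma num_addCA : left_commutative num_add.
Proof. by move=> m n p; rewrite !num_addA (num_addC m n). Qed.

Lemma num_0mul n : num_mul num0 n = num0.
Proof.
apply: (eqn_induction_numS (t := mulN zero v0) (u := zero) (ρ := enil M)) => [|k].
  by rewrite !eval_numE num_mul0.
by rewrite !eval_numE num_mulS num_0add => ->.
Qed.

Lemma num_mulSl m n : num_mul (numS m) n = num_add n (num_mul m n).
Proof.
apply: (eqn_induction_numS (t := mulN (succ v1) v0) (u := addN v0 (mulN v1 v0))
  (ρ := [env m])) => [|k]; first by rewrite !eval_numE !num_mul0 num_add0.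
by rewrite !eval_numE !num_mulS => ->; rewrite !num_addSl num_addCA.
Qed.

Lemma num_mulC : commutative num_mul.
Proof.
move=> m; apply: (eqn_induction_numS (t := mulN v1 v0) (u := mulN v0 v1)
  (ρ := [env m])) => [|k].
  by rewrite !eval_numE num_mul0 num_0mul.
by rewrite !eval_numE num_mulS num_mulSl => ->.
Qed.

Lemma num_mulDr : right_distributive num_mul num_add.
Proof.
move=> m n; apply: (eqn_induction_numS (t := mulN v1 (addN v2 v0))
  (u := addN (mulN v1 v2) (mulN v1 v0)) (ρ := [env m; n])) => [|k].
  by rewrite !eval_numE num_mul0 !num_add0.
by rewrite !eval_numE num_addS !num_mulS => ->; rewrite num_addCA.
Qed.

Lemma num_mulDl : left_distributive num_mul num_add.
Proof. by move=> m n p; rewrite num_mulC num_mulDr !(num_mulC p). Qed.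

Lemma num_mulA : associative num_mul.
Proof.
move=> m n; apply: (eqn_induction_numS (t := mulN v1 (mulN v2 v0))
  (u := mulN (mulN v1 v2) v0) (ρ := [env m; n])) => [|k].
  by rewrite !eval_numE !num_mul0.
by rewrite !eval_numE !num_mulS num_mulDr => ->.
Qed.

Lemma num_1mul : left_id num1 num_mul.
Proof. by move=> m; rewrite num_mulC num_mulS num_mul0 num_add0. Qed.

Lemma num1_neq0 : num1 <> num0.
Proof. exact: numS_neq0. Qed.

Lemma sat_Eq Γ (t u : tm Γ N) (ρ : env M Γ) : sat (t ≐ u) ρ = (eval t ρ = eval u ρ).
Proof. by []. Qed.

End Numbers.

HB.instance Definition _ (M : model) := gen_eqMixin (num M).
HB.instance Definition _ (M : model) := gen_choiceMixin (num M).
HB.instance Definition _ (M : model) := GRing.isNmodule.Build (num M)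
  (@num_addA M) (@num_addC M) (@num_0add M).
HB.instance Definition _ (M : model) := GRing.Nmodule_isComNzSemiRing.Build (num M)
  (@num_mulA M) (@num_mulC M) (@num_1mul M) (@num_mulDl M) (@num_0mul M)
  (introN eqP (@num1_neq0 M)).

Section NumberTheory.
Import GRing.Theory.
Local Open Scope ring_scope.
Variable M : model.
Implicit Types m n p : num M.

Lemma numSE n : numS n = n + 1.
Proof. by rewrite -[1]/(numS 0) [RHS]num_addS [num_add _ _]num_add0. Qed.

Lemma num_succ_neq0 n : n + 1 <> 0.
Proof. by rewrite -numSE; apply: numS_neq0. Qed.

Lemma qf_induction Γ (φ : fm (N :: Γ)) (ρ : env M Γ) : qf φ ->
  sat φ (econs (0 : num M) ρ) ->
  (forall n : num M, sat φ (econs n ρ) -> sat φ (econs (n + 1 : num M) ρ)) ->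
  forall n : num M, sat φ (econs n ρ).
Proof.
move=> qfφ base step; apply: qf_induction_numS => // n; rewrite numSE; exact: step.
Qed.

Lemma eqn_induction Γ (t u : tm (N :: Γ) N) (ρ : env M Γ) :
  eval t (econs (0 : num M) ρ) = eval u (econs (0 : num M) ρ) :> num M ->
  (forall n : num M, eval t (econs n ρ) = eval u (econs n ρ) :> num M ->
     eval t (econs (n + 1 : num M) ρ) = eval u (econs (n + 1 : num M) ρ) :> num M) ->
  forall n : num M, eval t (econs n ρ) = eval u (econs n ρ) :> num M.
Proof. exact: (qf_induction (φ := t ≐ u)). Qed.

Lemma eval_zero Γ (ρ : env M Γ) : eval zero ρ = (0 : num M).
Proof. by []. Qed.

Lemma eval_one Γ (ρ : env M Γ) : eval one ρ = (1 : num M).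
Proof. by []. Qed.

Lemma eval_succ Γ t (ρ : env M Γ) : eval (succ t) ρ = (eval t ρ : num M) + 1.
Proof. exact: numSE. Qed.

Lemma eval_two Γ (ρ : env M Γ) : eval two ρ = (2 : num M).
Proof. by rewrite eval_succ. Qed.

Lemma eval_addN Γ t u (ρ : env M Γ) :
  eval (addN t u) ρ = (eval t ρ : num M) + (eval u ρ : num M).
Proof. by []. Qed.

Lemma eval_mulN Γ t u (ρ : env M Γ) :
  eval (mulN t u) ρ = (eval t ρ : num M) * (eval u ρ : num M).
Proof. by []. Qed.

Definition evalE := (@eval_vz M, @eval_vs M, eval_zero, eval_one, eval_two, eval_succ,
  eval_addN, eval_mulN, @eval_num_pred M, @eval_num_sub M).

Lemma num_subr0 m : num_sub m 0 = m.
Proof. exact: num_sub0. Qed.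

Lemma num_predD1 n : num_pred (n + 1) = n.
Proof. by rewrite -numSE num_predS. Qed.

Lemma num_subD1 m n : num_sub m (n + 1) = num_pred (num_sub m n).
Proof. by rewrite -numSE num_subS. Qed.

Lemma num_sub_D1D1 m n : num_sub (m + 1) (n + 1) = num_sub m n.
Proof.
apply: (eqn_induction (t := monus (addN v1 one) (addN v0 one)) (u := monus v1 v0)
  (ρ := [env m])) => [|k]; rewrite !evalE.
  by rewrite num_subD1 !num_subr0 num_predD1.
by move=> IHk; rewrite num_subD1 IHk num_subD1.
Qed.

Lemma num_addK m n : num_sub (m + n) n = m.
Proof.
apply: (eqn_induction (t := monus (addN v1 v0) v0) (u := v1) (ρ := [env m])) => [|k];
  rewrite !evalE; first by rewrite num_subr0 addr0.
by rewrite addrA num_sub_D1D1.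
Qed.

Lemma num_addKl m n : num_sub (m + n) m = n.
Proof. by rewrite addrC num_addK. Qed.

Lemma num_addI : left_injective (@GRing.add (num M)).
Proof. by move=> p m n mp_np; rewrite -(num_addK m p) mp_np num_addK. Qed.

Lemma num_0VS n : n = 0 \/ exists m, n = m + 1.
Proof.
suff : sat (v0 ≐ zero ⊔ v0 ≐ succ (predN v0)) [env n].
  rewrite sat_Or !sat_Eq !evalE => -[n0|nS]; first by left.
  by right; exists (num_pred n).
apply: qf_induction => //; first by left.
by move=> k _; right; rewrite sat_Eq !evalE num_predD1.
Qed.

Lemma num_add_eq0 m n : m + n = 0 <-> m = 0 /\ n = 0.
Proof.
split=> [|[-> ->]]; last exact: addr0.
have [->|[k ->]] := num_0VS m; first by rewrite add0r.
by rewrite addrAC => /num_succ_neq0.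
Qed.

Lemma num_mul_eq0 m n : m * n = 0 <-> m = 0 \/ n = 0.
Proof.
split=> [|[->|->]]; [|exact: mul0r|exact: mulr0].
have [->|[k ->]] := num_0VS m; first by left.
have [->|[l ->]] := num_0VS n; first by right.
by rewrite mulrDl mul1r addrA => /num_succ_neq0.
Qed.

Lemma num_subC_cases m n : m + num_sub n m = n \/ n + num_sub m n = m.
Proof.
have := @qf_induction _ (addN v1 (monus v0 v1) ≐ v0 ⊔ addN v0 (monus v1 v0) ≐ v1) [env m].
apply=> [//||k]; rewrite !sat_Or !sat_Eq !evalE; first by right; rewrite num_subr0 add0r.
move=> [mk|km]; first by left; rewrite -mk -addrA num_addKl addrA.
have [mk_eq0|[l mk_eqS]] := num_0VS (num_sub m k); [left|right].
  by rewrite -km mk_eq0 addr0 num_addKl.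
have -> : m = k + 1 + l by rewrite -[LHS]km mk_eqS; ring.
by rewrite num_addKl.
Qed.

Lemma num_sub_eq0 m n : num_sub m n = 0 <-> exists p, m + p = n.
Proof.
split=> [mn0|[p <-]].
  have [<-|] := num_subC_cases m n; first by exists (num_sub n m).
  by rewrite mn0 addr0 => ->; exists 0; rewrite addr0.
apply: (eqn_induction (t := monus v1 (addN v1 v0)) (u := zero) (ρ := [env m])) => [|k];
  rewrite !evalE; first by rewrite addr0 -{1}(add0r m) num_addK.
by rewrite addrA num_subD1 => ->; exact: num_pred0.
Qed.

Lemma num_sub_sym_eq0 m n : num_sub m n + num_sub n m = 0 <-> m = n.
Proof.
rewrite num_add_eq0; split=> [[mn0 nm0]|->].
  by have [] := num_subC_cases m n; rewrite ?mn0 ?nm0 addr0.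
by split; apply/num_sub_eq0; exists 0; rewrite addr0.
Qed.

Lemma num_1sub_eq0 m : num_sub 1 m = 0 <-> m <> 0.
Proof.
have [->|[k ->]] := num_0VS m; first by rewrite num_sub0; split=> // /num1_neq0.
split=> _; first exact: num_succ_neq0.
by apply/num_sub_eq0; exists k; rewrite addrC.
Qed.

Lemma num_embedding :
  exists (F : realFieldType) (ι : {rmorphism num M -> F}),
    injective ι /\ forall n, (0 <= ι n)%R.
Proof.
apply: semiring_field_embedding.
- exact: num_addI.
- by move=> m n; have [mn|nm] := num_subC_cases m n;
    [exists (num_sub n m); left|exists (num_sub m n); right].
- by move=> m n /num_add_eq0[].
- by move=> m n /num_mul_eq0.
Qed.

End NumberTheory.

(** * Arithmetical comprehension, induction and choice *)

Fixpoint arith Γ (φ : fm Γ) : Prop :=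
  match φ with
  | Eq _ _ _ | Bot _ => True
  | Imp _ φ ψ | And _ φ ψ | Or _ φ ψ => arith φ /\ arith ψ
  | All _ σ φ | Ex _ σ φ => σ = N /\ arith φ
  end.

Lemma arith_sub Γ (φ : fm Γ) Δ (s : sub Γ Δ) : arith φ -> arith (sub_fm φ s).
Proof.
elim: φ Δ s => {Γ} //=.
1-3: by move=> Γ φ IHφ ψ IHψ Δ s [/IHφ ? /IHψ ?].
1-2: by move=> Γ σ φ IHφ Δ s [? /IHφ ?].
Qed.

(* With [e] denoting ∃², [chi φ e] vanishes exactly when [φ] holds; quantifiers
   over types other than [N] get a junk value. *)
Fixpoint chi Γ (φ : fm Γ) : tm Γ (B ⇒ N) -> tm Γ N :=
  match φ with
  | Eq _ t u => fun _ => addN (monus t u) (monus u t)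
  | Bot _ => fun _ => one
  | Imp _ φ ψ => fun e => mulN (monus one (chi φ e)) (chi ψ e)
  | And _ φ ψ => fun e => addN (chi φ e) (chi ψ e)
  | Or _ φ ψ => fun e => mulN (chi φ e) (chi ψ e)
  | All Γ σ φ => fun e =>
      match σ return tm (σ :: Γ) N -> tm Γ N with
      | N => fun c => monus one (e ⋅ lam (monus one c))
      | _ => fun _ => zero
      end (chi φ (wk e))
  | Ex Γ σ φ => fun e =>
      match σ return tm (σ :: Γ) N -> tm Γ N with
      | N => fun c => e ⋅ lam c
      | _ => fun _ => zero
      end (chi φ (wk e))
  end.

Section Comprehension.
Import GRing.Theory.
Local Open Scope ring_scope.
Variable M : model.
Hypothesis M_ACA0w : models M ACA0w.

Lemma exists_functional_ex :
  exists E : dom M (B ⇒ N),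
    forall f, E ∙ f = (0 : num M) <-> exists n, f ∙ n = (0 : num M).
Proof.
have [E EP] := M_ACA0w (enil M) (ax_exists2 []).
by exists E => f; have [_ [? ?]] := EP f; split.
Qed.

Definition exists_functional : dom M (B ⇒ N) := sval (cid exists_functional_ex).

Lemma exists_functionalP f :
  exists_functional ∙ f = (0 : num M) <-> exists n, f ∙ n = (0 : num M).
Proof. exact: (svalP (cid exists_functional_ex)). Qed.

Lemma chiP Γ (φ : fm Γ) (ρ : env M Γ) (e : tm Γ (B ⇒ N)) : arith φ ->
  eval e ρ = exists_functional -> eval (chi φ e) ρ = (0 : num M) <-> sat φ ρ.
Proof.
elim: φ ρ e => {Γ}.
- by move=> Γ t u ρ e _ _; rewrite [chi _ _]/= !evalE num_sub_sym_eq0.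
- by move=> Γ ρ e _ _; split=> // /num1_neq0.
- move=> Γ φ IHφ ψ IHψ ρ e [aφ aψ] eE; rewrite [chi _ _]/= !evalE num_mul_eq0.
  rewrite num_1sub_eq0 IHφ // IHψ // sat_Imp; split=> [[//|//]|φψ].
  by have [/φψ|] := pselect (sat φ ρ); [right|left].
- move=> Γ φ IHφ ψ IHψ ρ e [aφ aψ] eE.
  by rewrite [chi _ _]/= !evalE num_add_eq0 IHφ // IHψ.
- move=> Γ φ IHφ ψ IHψ ρ e [aφ aψ] eE.
  by rewrite [chi _ _]/= !evalE num_mul_eq0 IHφ // IHψ.
- move=> Γ σ φ IHφ ρ e [eN aφ] eE; subst σ.
  rewrite [chi _ _]/= !evalE [eval (e ⋅ _) ρ]/= eE num_1sub_eq0 exists_functionalP.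
  have chi_neg a : eval (lam (monus one (chi φ (wk e)))) ρ ∙ a = (0 : num M) <->
      ~ sat φ (econs a ρ).
    by rewrite eval_lam !evalE num_1sub_eq0 IHφ // eval_wk.
  split=> [nex a|all [a /chi_neg]]; last by apply; apply: all.
  by apply: contrapT => /chi_neg na; apply: nex; exists a.
- move=> Γ σ φ IHφ ρ e [eN aφ] eE; subst σ.
  rewrite [chi _ _]/= [eval _ _]/= eE exists_functionalP.
  have chi_at a : eval (lam (chi φ (wk e))) ρ ∙ a = (0 : num M) <-> sat φ (econs a ρ).
    by rewrite eval_lam IHφ // eval_wk.
  by split=> -[a /chi_at ?]; exists a.
Qed.

Lemma arith_characteristic Γ (φ : fm Γ) : arith φ ->
  exists c : tm ((B ⇒ N) :: Γ) N,
    forall ρ, eval c (econs exists_functional ρ) = (0 : num M) <-> sat φ ρ.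
Proof.
move=> aφ; exists (chi (wk_fm φ) v0) => ρ.
by rewrite chiP //; [exact: sat_wk_fm|exact: arith_sub].
Qed.

Lemma arith_comprehension Γ σ (φ : fm (σ :: Γ)) (ρ : env M Γ) : arith φ ->
  exists f : dom M (σ ⇒ N), forall a, f ∙ a = (0 : num M) <-> sat φ (econs a ρ).
Proof.
move=> /arith_characteristic[c cP].
pose F := eval (lam (lam c)) ρ.
exists (eval (lam (v1 ⋅ v0 ⋅ v2)) [env F; exists_functional]) => a.
by rewrite eval_lam -cP -[eval (_ ⋅ _) _]/(F ∙ a ∙ exists_functional) /F !eval_lam.
Qed.

Lemma arith_comprehension2 Γ σ τ (φ : fm (σ :: τ :: Γ)) (ρ : env M Γ) : arith φ ->
  exists f : dom M (σ ⇒ τ ⇒ N),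
    forall a b, f ∙ a ∙ b = (0 : num M) <-> sat φ (econs a (econs b ρ)).
Proof.
move=> /arith_characteristic[c cP].
pose F := eval (lam (lam (lam c))) ρ.
exists (eval (lam (lam (v2 ⋅ v0 ⋅ v1 ⋅ v3))) [env F; exists_functional]) => a b.
by rewrite !eval_lam -cP -[eval (_ ⋅ _) _]/(F ∙ b ∙ a ∙ exists_functional) /F !eval_lam.
Qed.

Lemma arith_induction Γ (φ : fm (N :: Γ)) (ρ : env M Γ) : arith φ ->
  sat φ (econs (0 : num M) ρ) ->
  (forall n : num M, sat φ (econs n ρ) -> sat φ (econs (n + 1 : num M) ρ)) ->
  forall n : num M, sat φ (econs n ρ).
Proof.
move=> /(arith_comprehension ρ)[f fP] base step n; apply/fP; move: n.
apply: (eqn_induction (t := v1 ⋅ v0) (u := zero) (ρ := [env f])); first exact/fP.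
by move=> n /fP/step/fP.
Qed.

Lemma arith_last Γ (φ : fm (N :: Γ)) (ρ : env M Γ) (b : num M) : arith φ ->
  sat φ (econs (0 : num M) ρ) -> ~ sat φ (econs b ρ) ->
  exists n : num M, sat φ (econs n ρ) /\ ~ sat φ (econs (n + 1 : num M) ρ).
Proof.
move=> aφ base nb; apply: contrapT => nex; apply: nb.
apply: (arith_induction aφ base) => n φn.
by apply: contrapT => nφSn; apply: nex; exists n.
Qed.

End Comprehension.

Lemma models_ACA0w (M : structure) : models M ACA0w_QFAC01 -> models M ACA0w.
Proof. by move=> M_models Γ φ ρ ax; apply/M_models/ACA0w_QFAC01_base. Qed.

Lemma arith_choice (M : model) Γ (φ : fm (B :: N :: Γ)) (ρ : env M Γ) :
  models M ACA0w_QFAC01 -> arith φ ->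
  (forall n, exists f, sat φ (econs f (econs n ρ))) ->
  exists F : dom M (N ⇒ B), forall n, sat φ (econs (F ∙ n) (econs n ρ)).
Proof.
move=> M_models /(arith_comprehension2 (models_ACA0w M_models) ρ)[Y YP] total.
have [n|F FP] := M_models _ _ (enil M) (ax_qfac01 []) Y.
  by have [f /YP Yfn] := total n; exists f.
by exists F => n; apply/YP; apply: FP.
Qed.

(** * Rationals and reals of a model *)

Section Coding.
Import GRing.Theory.
Local Open Scope ring_scope.
Variable M : model.
Implicit Types m n p q : num M.

Definition exp2 n : num M := eval (pow2 v0) [env n].
Definition triangle n : num M := eval (tri v0) [env n].
Definition triangle_root p : num M := eval (root v0) [env p].
Definition num_pair m n : num M := triangle (m + n) + n.
Definition num_snd p : num M := num_sub p (triangle (triangle_root p)).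
Definition num_fst p : num M := num_sub (triangle_root p) (num_snd p).
Definition qpos q : num M := num_fst (num_fst q).
Definition qneg q : num M := num_snd (num_fst q).
Definition qden q : num M := num_snd q + 1.

Lemma eval_pow2 Γ (t : tm Γ N) (ρ : env M Γ) : eval (pow2 t) ρ = exp2 (eval t ρ).
Proof. by []. Qed.

Lemma eval_tri Γ (t : tm Γ N) (ρ : env M Γ) : eval (tri t) ρ = triangle (eval t ρ).
Proof. by []. Qed.

Lemma eval_root Γ (t : tm Γ N) (ρ : env M Γ) :
  eval (root t) ρ = triangle_root (eval t ρ).
Proof. by []. Qed.

Lemma eval_pairN Γ (t u : tm Γ N) (ρ : env M Γ) :
  eval (pairN t u) ρ = num_pair (eval t ρ) (eval u ρ).
Proof. by []. Qed.

Lemma eval_fstN Γ (t : tm Γ N) (ρ : env M Γ) : eval (fstN t) ρ = num_fst (eval t ρ).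
Proof. by []. Qed.

Lemma eval_sndN Γ (t : tm Γ N) (ρ : env M Γ) : eval (sndN t) ρ = num_snd (eval t ρ).
Proof. by []. Qed.

Lemma eval_pos Γ (t : tm Γ N) (ρ : env M Γ) : eval (pos t) ρ = qpos (eval t ρ).
Proof. by []. Qed.

Lemma eval_neg Γ (t : tm Γ N) (ρ : env M Γ) : eval (neg t) ρ = qneg (eval t ρ).
Proof. by []. Qed.

Lemma eval_den Γ (t : tm Γ N) (ρ : env M Γ) : eval (den t) ρ = qden (eval t ρ).
Proof. by rewrite eval_succ. Qed.

Lemma eval_App Γ σ τ (t : tm Γ (σ ⇒ τ)) u (ρ : env M Γ) :
  eval (t ⋅ u) ρ = eval t ρ ∙ eval u ρ.
Proof. by []. Qed.

Lemma eval_rec Γ (f : tm Γ (N ⇒ N ⇒ N)) (t u : tm Γ N) (ρ : env M Γ) :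
  eval (rec f t u) ρ = icst M cRec ∙ eval f ρ ∙ eval t ρ ∙ eval u ρ.
Proof. by []. Qed.

Definition eval_codeE := (@evalE M, eval_pow2, eval_tri, eval_root, eval_pairN,
  eval_fstN, eval_sndN, eval_pos, eval_neg, eval_den).

Lemma eval_wk_app Γ σ τ (t : tm Γ (σ ⇒ τ)) (a : dom M σ) (ρ : env M Γ) :
  eval (wk t ⋅ v0) (econs a ρ) = eval t ρ ∙ a.
Proof. by rewrite eval_App eval_wk. Qed.

Lemma recD1 (f : dom M (N ⇒ N ⇒ N)) a n :
  icst M cRec ∙ f ∙ a ∙ (n + 1) = f ∙ n ∙ (icst M cRec ∙ f ∙ a ∙ n).
Proof. by rewrite -numSE rec_S. Qed.

Lemma exp2_0 : exp2 0 = 1.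
Proof. exact: rec_0. Qed.

Lemma exp2D1 n : exp2 (n + 1) = exp2 n + exp2 n.
Proof. by rewrite /exp2 /pow2 !eval_rec !evalE recD1 !eval_lam. Qed.

Lemma triangle0 : triangle 0 = 0.
Proof. exact: rec_0. Qed.

Lemma triangleD1 n : triangle (n + 1) = triangle n + (n + 1).
Proof. by rewrite /triangle /tri !eval_rec !evalE recD1 !eval_lam !evalE. Qed.

Lemma triangle_root0 : triangle_root 0 = 0.
Proof. exact: rec_0. Qed.

Lemma triangle_rootD1 p : triangle_root (p + 1) =
  triangle_root p + num_sub 1 (num_sub (triangle (triangle_root p + 1)) (p + 1)).
Proof.
by rewrite /triangle_root /root !eval_rec !evalE recD1 !eval_lam !eval_codeE.
Qed.

Lemma triangle_double n : triangle n + triangle n = n * (n + 1).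
Proof.
apply: (eqn_induction (t := addN (tri v0) (tri v0)) (u := mulN v0 (addN v0 one))
  (ρ := enil M)) => [|k]; rewrite !eval_codeE; first by rewrite triangle0 mul0r addr0.
by move=> IHk; rewrite triangleD1 addrACA IHk; ring.
Qed.
End Coding.

Section Reals.
Import Order.TTheory GRing.Theory Num.Theory.
Local Open Scope ring_scope.
Variables (M : model) (F : realFieldType) (ι : {rmorphism num M -> F}).
Hypothesis ι_inj : injective ι.
Hypothesis ι_ge0 : forall n, 0 <= ι n.
Implicit Types m n p q : num M.

Lemma ιD1 n : ι (n + 1) = ι n + 1.
Proof. by rewrite rmorphD rmorph1. Qed.

Lemma num_sub_le m n : num_sub m n = 0 <-> ι m <= ι n.
Proof.
rewrite num_sub_eq0; split=> [[p <-]|le_mn]; first by rewrite rmorphD lerDl ι_ge0.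
have [mn|nm] := num_subC_cases m n; first by exists (num_sub n m).
exists 0; rewrite addr0; apply: ι_inj; apply: le_anti.
by rewrite le_mn -nm rmorphD lerDl ι_ge0.
Qed.

Lemma ι_le_addP m n : ι m <= ι n <-> exists p, m + p = n.
Proof. by rewrite -num_sub_le num_sub_eq0. Qed.

Lemma ι_ltD1 m n : (ι m < ι n) = (ι (m + 1) <= ι n).
Proof.
apply/idP/idP => [lt_mn|]; last by rewrite ιD1; lra.
have /ι_le_addP[p def_n] := ltW lt_mn; move: lt_mn; rewrite -def_n.
have [->|[q ->]] := num_0VS p; first by rewrite addr0 ltxx.
by rewrite !rmorphD; have := ι_ge0 q; lra.
Qed.

Lemma ι_sub m n : ι n <= ι m -> ι (num_sub m n) = ι m - ι n.
Proof. by move=> /ι_le_addP[p <-]; rewrite num_addKl rmorphD; lra. Qed.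

Lemma sat_leN Γ (t u : tm Γ N) (ρ : env M Γ) :
  sat (leN t u) ρ <-> ι (eval t ρ) <= ι (eval u ρ).
Proof. exact: num_sub_le. Qed.

Lemma sat_ltN Γ (t u : tm Γ N) (ρ : env M Γ) :
  sat (ltN t u) ρ <-> ι (eval t ρ) < ι (eval u ρ).
Proof. by rewrite sat_leN eval_succ ι_ltD1. Qed.

Lemma ι_triangle n : 2 * ι (triangle n) = ι n * (ι n + 1).
Proof. by rewrite -ιD1 -rmorphM -triangle_double rmorphD; ring. Qed.

Lemma triangle_root_bounds p :
  ι (triangle (triangle_root p)) <= ι p < ι (triangle (triangle_root p + 1)).
Proof.
suff : sat (leN (tri (root v0)) v0 ⊓ ltN v0 (tri (succ (root v0)))) [env p].
  by rewrite sat_And sat_ltN sat_leN !eval_codeE => -[-> ->].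
apply: qf_induction => // [|k]; rewrite !sat_And !sat_ltN !sat_leN !eval_codeE.
  by rewrite triangle_root0 triangleD1 triangle0 !rmorphD rmorph0 rmorph1; lra.
move=> [lo hi]; rewrite triangle_rootD1; set w := triangle_root k in lo hi *.
have [w_le|w_gt] := pselect (num_sub (triangle (w + 1)) (k + 1) = 0).
  rewrite w_le num_subr0; move/num_sub_le: w_le => w_le; split=> //.
  move: hi (ι_ge0 (w + 1)); rewrite ι_ltD1 (triangleD1 (w + 1)) !rmorphD rmorph1.
  by lra.
have -> : num_sub 1 (num_sub (triangle (w + 1)) (k + 1)) = 0 by apply/num_1sub_eq0.
rewrite addr0; split; first by rewrite ιD1; lra.
by rewrite ltNge; apply/negP => /num_sub_le.
Qed.

Lemma triangle_root_unique p w :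
  ι (triangle w) <= ι p < ι (triangle (w + 1)) -> triangle_root p = w.
Proof.
have ge0_triangle_lt m n : ι (triangle m) < ι (triangle (n + 1)) -> ι m <= ι n.
  move=> mn; rewrite leNgt ι_ltD1; apply/negP => nm; have := ι_triangle m.
  by have := ι_triangle (n + 1); have := ι_ge0 (n + 1); nra.
have /andP[lo hi] := triangle_root_bounds p => /andP[lo' hi'].
by apply/ι_inj/le_anti/andP; split; apply: ge0_triangle_lt; lra.
Qed.

Lemma triangle_root_pair m n : triangle_root (num_pair m n) = m + n.
Proof.
apply: triangle_root_unique; rewrite /num_pair triangleD1 !rmorphD rmorph1.
by have := ι_ge0 m; have := ι_ge0 n; lra.
Qed.

Lemma num_snd_pair m n : num_snd (num_pair m n) = n.
Proof. by rewrite /num_snd triangle_root_pair num_addKl. Qed.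

Lemma num_fst_pair m n : num_fst (num_pair m n) = m.
Proof. by rewrite /num_fst num_snd_pair triangle_root_pair num_addK. Qed.

Definition qval q : F := (ι (qpos q) - ι (qneg q)) / ι (qden q).

Lemma ι_qden_gt0 q : 0 < ι (qden q).
Proof. by rewrite ιD1; have := ι_ge0 (num_snd q); lra. Qed.

Lemma qval_rat Γ (a b d : tm Γ N) (ρ : env M Γ) : 0 < ι (eval d ρ) ->
  qval (eval (rat a b d) ρ) = (ι (eval a ρ) - ι (eval b ρ)) / ι (eval d ρ).
Proof.
rewrite /rat !eval_codeE /qval /qpos /qneg /qden !(num_fst_pair, num_snd_pair).
have [->|[k ->]] := num_0VS (eval d ρ); first by rewrite rmorph0 ltxx.
by rewrite num_predD1.
Qed.

Lemma qval_qadd Γ (q r : tm Γ N) (ρ : env M Γ) :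
  qval (eval (qadd q r) ρ) = qval (eval q ρ) + qval (eval r ρ).
Proof.
have q0 := ι_qden_gt0 (eval q ρ); have r0 := ι_qden_gt0 (eval r ρ).
rewrite qval_rat !eval_codeE rmorphM ?mulr_gt0 // /qval.
move: (qden _) (qden _) q0 r0 => c d c0 d0; rewrite !(rmorphD, rmorphM).
by field; rewrite !gt_eqF.
Qed.

Lemma qval_qsub Γ (q r : tm Γ N) (ρ : env M Γ) :
  qval (eval (qsub q r) ρ) = qval (eval q ρ) - qval (eval r ρ).
Proof.
have q0 := ι_qden_gt0 (eval q ρ); have r0 := ι_qden_gt0 (eval r ρ).
rewrite qval_rat !eval_codeE rmorphM ?mulr_gt0 // /qval.
move: (qden _) (qden _) q0 r0 => c d c0 d0; rewrite !(rmorphD, rmorphM).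
by field; rewrite !gt_eqF.
Qed.

Lemma ι_distance m n : ι (num_sub m n + num_sub n m) = `|ι m - ι n|.
Proof.
rewrite rmorphD; have [mn|/ltW nm] := leP (ι m) (ι n).
  by rewrite (ι_sub mn) (proj2 (num_sub_le _ _) mn) rmorph0 ler0_norm; lra.
by rewrite (ι_sub nm) (proj2 (num_sub_le _ _) nm) rmorph0 ger0_norm; lra.
Qed.

Lemma qval_qabs Γ (q : tm Γ N) (ρ : env M Γ) :
  qval (eval (qabs q) ρ) = `|qval (eval q ρ)|.
Proof.
have q0 := ι_qden_gt0 (eval q ρ).
rewrite qval_rat !eval_codeE // ι_distance rmorph0 subr0 /qval normrM normfV.
by rewrite (gtr0_norm q0).
Qed.

Lemma qval_le q r : (qval q <= qval r) =
  (ι (qpos q) * ι (qden r) + ι (qneg r) * ι (qden q) <=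
   ι (qpos r) * ι (qden q) + ι (qneg q) * ι (qden r)).
Proof.
have q0 := ι_qden_gt0 q; have r0 := ι_qden_gt0 r.
rewrite /qval ler_pdivrMr // mulrAC ler_pdivlMr //.
by apply/idP/idP; lra.
Qed.

Lemma sat_qle Γ (q r : tm Γ N) (ρ : env M Γ) :
  sat (qle q r) ρ <-> qval (eval q ρ) <= qval (eval r ρ).
Proof.
rewrite sat_leN !eval_codeE qval_le; move: (qden _) (qden _) => c d.
by rewrite !(rmorphD, rmorphM).
Qed.

Lemma sat_qlt Γ (q r : tm Γ N) (ρ : env M Γ) :
  sat (qlt q r) ρ <-> qval (eval q ρ) < qval (eval r ρ).
Proof.
rewrite sat_ltN !eval_codeE !ltNge qval_le; move: (qden _) (qden _) => c d.
by rewrite !(rmorphD, rmorphM).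
Qed.

Definition pow2neg n : F := (ι (exp2 n))^-1.

Lemma ι_exp2_gt0 n : 0 < ι (exp2 n).
Proof.
suff : sat (ltN zero (pow2 v0)) [env n] by rewrite sat_ltN !eval_codeE rmorph0.
apply: qf_induction => // [|k]; rewrite !sat_ltN !eval_codeE rmorph0.
  by rewrite exp2_0 rmorph1.
by rewrite exp2D1 rmorphD; lra.
Qed.

Lemma ι_exp2K n : ι (exp2 n) * pow2neg n = 1.
Proof. by rewrite mulfV // gt_eqF // ι_exp2_gt0. Qed.

Lemma pow2neg_gt0 n : 0 < pow2neg n.
Proof. by rewrite invr_gt0 ι_exp2_gt0. Qed.

Lemma pow2neg0 : pow2neg 0 = 1.
Proof. by rewrite /pow2neg exp2_0 rmorph1 invr1. Qed.

Lemma pow2negD1 n : pow2neg (n + 1) = pow2neg n / 2.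
Proof. by rewrite /pow2neg exp2D1 rmorphD -mulr2n -[_ *+ 2]mulr_natr invfM. Qed.

Lemma pow2neg_le m n : ι m <= ι n -> pow2neg n <= pow2neg m.
Proof.
move=> /ι_le_addP[p <-]; rewrite lef_pV2 ?posrE ?ι_exp2_gt0 //.
suff : sat (leN (pow2 v1) (pow2 (addN v1 v0))) [env p; m].
  by rewrite sat_leN !eval_codeE.
apply: qf_induction => // [|k]; rewrite !sat_leN !eval_codeE ?addr0 //.
by rewrite addrA exp2D1 rmorphD; have := ι_exp2_gt0 (m + k); lra.
Qed.

Lemma pow2neg_le1 n : pow2neg n <= 1.
Proof. by rewrite -pow2neg0; apply: pow2neg_le; rewrite rmorph0. Qed.

Lemma qval_dyadic Γ (c n : tm Γ N) (ρ : env M Γ) :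
  qval (eval (dyadic c n) ρ) = ι (eval c ρ) * pow2neg (eval n ρ).
Proof. by rewrite qval_rat !eval_codeE ?ι_exp2_gt0 // rmorph0 subr0. Qed.

Lemma qval_dyadic0 Γ (n : tm Γ N) (ρ : env M Γ) : qval (eval (dyadic zero n) ρ) = 0.
Proof. by rewrite qval_dyadic rmorph0 mul0r. Qed.

Lemma qval_dyadic1 Γ (n : tm Γ N) (ρ : env M Γ) :
  qval (eval (dyadic one n) ρ) = pow2neg (eval n ρ).
Proof. by rewrite qval_dyadic eval_one rmorph1 mul1r. Qed.

Lemma qval_dyadic2 Γ (n : tm Γ N) (ρ : env M Γ) :
  qval (eval (dyadic two n) ρ) = 2 * pow2neg (eval n ρ).
Proof. by rewrite qval_dyadic eval_two rmorph_nat. Qed.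

Definition is_real (x : dom M B) : Prop :=
  forall n m : num M, `|qval (x ∙ n) - qval (x ∙ (n + m))| < pow2neg n.

Definition real_lt (x y : dom M B) : Prop :=
  exists n, qval (x ∙ n) + 2 * pow2neg n < qval (y ∙ n).

Definition near_unit (q n : num M) : Prop :=
  - (2 * pow2neg n) <= qval q <= 1 + 2 * pow2neg n.

Definition in_unit (x : dom M B) : Prop := forall n, near_unit (x ∙ n) n.

Definition in_open (h : dom M (B ⇒ B)) (x : dom M B) : Prop :=
  exists n, 2 * pow2neg n < qval (h ∙ x ∙ n).

Definition in_ball (z y : dom M B) (k : num M) : Prop :=
  exists n : num M,
    `|qval (z ∙ (n + 1)) - qval (y ∙ (n + 1))| + 2 * pow2neg n < pow2neg k.

Lemma sat_isReal Γ (t : tm Γ B) (ρ : env M Γ) : sat (isReal t) ρ <-> is_real (eval t ρ).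
Proof.
apply: sat_All_iff => n; apply: sat_All_iff => m.
by rewrite sat_qlt qval_qabs qval_qsub qval_dyadic1 !eval_App !eval_wk.
Qed.

Lemma sat_rlt Γ (t u : tm Γ B) (ρ : env M Γ) :
  sat (rlt t u) ρ <-> real_lt (eval t ρ) (eval u ρ).
Proof.
apply: sat_Ex_iff => n.
by rewrite sat_qlt qval_qadd qval_dyadic2 !eval_wk_app.
Qed.

Lemma eval_rconst Γ (q : tm Γ N) (ρ : env M Γ) n : eval (rconst q) ρ ∙ n = eval q ρ.
Proof. exact: ap_cK. Qed.

Lemma sat_mem Γ (t : tm Γ B) (h : tm Γ (B ⇒ B)) (ρ : env M Γ) :
  sat (mem t h) ρ <-> in_open (eval h ρ) (eval t ρ).
Proof.
apply: sat_Ex_iff => n; rewrite sat_qlt qval_qadd qval_dyadic2 !eval_wk_app.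
by rewrite eval_rconst qval_dyadic0 add0r.
Qed.

Lemma qval_rabs_rsub Γ (t u : tm Γ B) (ρ : env M Γ) (n : num M) :
  qval (eval (rabs (rsub t u)) ρ ∙ n) =
  `|qval (eval t ρ ∙ (n + 1)) - qval (eval u ρ ∙ (n + 1))|.
Proof.
rewrite eval_lam qval_qabs eval_App eval_wk /rsub eval_lam qval_qsub.
by rewrite !(eval_App (wk _)) !eval_wk eval_succ.
Qed.

Lemma sat_inBall Γ (z y : tm Γ B) (k : tm Γ N) (ρ : env M Γ) :
  sat (inBall z y k) ρ <-> in_ball (eval z ρ) (eval y ρ) (eval k ρ).
Proof.
apply: sat_Ex_iff => n; rewrite sat_qlt qval_qadd qval_dyadic2 !eval_wk_app.
by rewrite qval_rabs_rsub eval_rconst qval_dyadic1.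
Qed.

Lemma sat_in01 Γ (t : tm Γ B) (ρ : env M Γ) : sat (in01 t) ρ <-> in_unit (eval t ρ).
Proof.
have ge0 : sat (rle rzero t) ρ <-> forall n, 0 <= qval (eval t ρ ∙ n) + 2 * pow2neg n.
  apply: sat_All_iff => n; rewrite sat_qle qval_qadd qval_dyadic2 !eval_wk_app.
  by rewrite eval_rconst qval_dyadic0.
have le1 : sat (rle t rone) ρ <-> forall n, qval (eval t ρ ∙ n) <= 1 + 2 * pow2neg n.
  apply: sat_All_iff => n; rewrite sat_qle qval_qadd qval_dyadic2 !eval_wk_app.
  by rewrite eval_rconst qval_dyadic1 eval_zero pow2neg0.
rewrite sat_And ge0 le1 /in_unit /near_unit; split=> [[lo hi] n|bounds].
  by have := lo n; have := hi n; lra.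
by split=> n; have := bounds n; lra.
Qed.

Lemma is_real_near x (m n : num M) : is_real x -> ι m <= ι n ->
  `|qval (x ∙ m) - qval (x ∙ n)| < pow2neg m.
Proof. by move=> rx /ι_le_addP[p <-]; apply: rx. Qed.

(* At an index beyond all witnesses of [a < z < b] the rationals approximating z lie
   between those of a and b. *)
Lemma between_near a b z (k : num M) : is_real a -> is_real b -> is_real z ->
  in_ball a b k -> real_lt a z -> real_lt z b ->
  `|qval (z ∙ k) - qval (a ∙ k)| <= 3 * pow2neg k.
Proof.
move=> ra rb rz [i ab_i] [m1 az] [m2 zb].
pose n : num M := m1 + m2 + (i + 1 + k).
have [m1n m2n i1n kn] : [/\ ι m1 <= ι n, ι m2 <= ι n, ι (i + 1) <= ι n & ι k <= ι n].
  have := ι_ge0 m1; have := ι_ge0 m2; have := ι_ge0 (i + 1); have := ι_ge0 k.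
  by rewrite /n !rmorphD; split; lra.
have := is_real_near ra m1n; have := is_real_near rz m1n.
have := is_real_near rb m2n; have := is_real_near rz m2n.
have := is_real_near ra i1n; have := is_real_near rb i1n.
have := is_real_near ra kn; have := is_real_near rz kn.
have := pow2negD1 i; have := pow2neg_gt0 i; move: ab_i; rewrite -ltrBrDr.
rewrite !ltr_norml ler_norml; lra.
Qed.

(** * The Lebesgue number lemma *)

Definition head (f : dom M B) : num M := f ∙ (0 : num M).

(* A function f codes the rational [center f] and the sequence of functions
   [point f n], by f i = (center f, point f (i)_0 (i)_1). *)
Definition center (f : dom M B) : num M := num_fst (head f).

Definition point_tm Γ (f : tm Γ B) (n : tm Γ N) : tm Γ B :=
  lam (sndN (wk f ⋅ pairN (wk n) v0)).

Definition point (f : dom M B) (n : num M) : dom M B := eval (point_tm v0 v1) [env f; n].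

Definition code_of (c : num M) (Z : dom M (N ⇒ B)) : dom M B :=
  eval (lam (pairN v1 (v2 ⋅ fstN v0 ⋅ sndN v0))) [env c; Z].

Lemma pointE f n (i : num M) : point f n ∙ i = num_snd (f ∙ num_pair n i).
Proof. by rewrite /point /point_tm eval_lam. Qed.

Lemma code_ofE c Z (i : num M) :
  code_of c Z ∙ i = num_pair c (Z ∙ num_fst i ∙ num_snd i).
Proof. by rewrite /code_of eval_lam. Qed.

Lemma eval_point_tm Γ (f : tm Γ B) (n : tm Γ N) (ρ : env M Γ) :
  eval (point_tm f n) ρ = point (eval f ρ) (eval n ρ).
Proof.
apply: ap_ext => i; rewrite pointE /point_tm eval_lam.
by rewrite eval_sndN eval_App eval_pairN !eval_wk.
Qed.

Lemma center_code c Z : center (code_of c Z) = c.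
Proof. by rewrite /center /head code_ofE num_fst_pair. Qed.

Lemma point_code c Z n : point (code_of c Z) n = Z ∙ n.
Proof.
apply: ap_ext => i; rewrite pointE code_ofE.
by rewrite num_snd_pair num_fst_pair num_snd_pair.
Qed.

Definition near_unit_fm Γ (q n : tm Γ N) : fm Γ :=
  qle (dyadic zero zero) (qadd q (dyadic two n)) ⊓
  qle q (qadd (dyadic one zero) (dyadic two n)).

Lemma sat_near_unit_fm Γ (q n : tm Γ N) (ρ : env M Γ) :
  sat (near_unit_fm q n) ρ <-> near_unit (eval q ρ) (eval n ρ).
Proof.
rewrite sat_And !sat_qle (qval_qadd q) (qval_qadd (dyadic one zero)).
rewrite qval_dyadic0 qval_dyadic1 !qval_dyadic2 eval_zero pow2neg0 /near_unit.
by split=> [[]|/andP[]]; [|split]; lra.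
Qed.

Definition escape (O : dom M (N ⇒ B ⇒ B)) (z : dom M B) (n k c : num M) : Prop :=
  [/\ is_real z, ~ in_open (O ∙ n) z & `|qval (z ∙ k) - qval c| <= 3 * pow2neg k].

Definition escape_fm Γ (O : tm Γ (N ⇒ B ⇒ B)) (z : tm Γ B) (n k c : tm Γ N) : fm Γ :=
  isReal z ⊓ Neg (mem z (O ⋅ n)) ⊓
  qle (qabs (qsub (z ⋅ k) c)) (dyadic (succ two) k).

Lemma sat_escape_fm Γ (O : tm Γ (N ⇒ B ⇒ B)) (z : tm Γ B) (n k c : tm Γ N)
    (ρ : env M Γ) : sat (escape_fm O z n k c) ρ <->
  escape (eval O ρ) (eval z ρ) (eval n ρ) (eval k ρ) (eval c ρ).
Proof.
have three : 2 + 1 = 3 :> F by ring.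
rewrite !sat_And sat_Neg sat_isReal sat_mem sat_qle qval_qabs qval_qsub qval_dyadic.
rewrite eval_succ eval_two rmorphD rmorph_nat rmorph1 three !eval_App.
by split=> [[? []]|[]].
Qed.

Definition escape_code O (f : dom M B) (k : num M) : Prop :=
  near_unit (center f) k /\ forall n, escape O (point f n) n k (center f).

Definition escape_code_fm Γ (O : tm Γ (N ⇒ B ⇒ B)) (f : tm Γ B) (k : tm Γ N) : fm Γ :=
  near_unit_fm (fstN (f ⋅ zero)) k ⊓
  ∀[N] escape_fm (wk O) (point_tm (wk f) v0) v0 (wk k) (fstN (wk f ⋅ zero)).

Lemma sat_escape_code_fm Γ (O : tm Γ (N ⇒ B ⇒ B)) (f : tm Γ B) (k : tm Γ N)
    (ρ : env M Γ) :
  sat (escape_code_fm O f k) ρ <-> escape_code (eval O ρ) (eval f ρ) (eval k ρ).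
Proof.
rewrite sat_And sat_near_unit_fm (sat_All_iff (P := fun n => escape (eval O ρ)
  (point (eval f ρ) n) n (eval k ρ) (center (eval f ρ)))) // => n.
by rewrite sat_escape_fm eval_point_tm !eval_fstN !eval_App !eval_wk.
Qed.

Section LebesgueNumber.
Hypothesis M_models : models M ACA0w_QFAC01.
Variable O : dom M (N ⇒ B ⇒ B).
Hypothesis O_open : forall n x, is_real x -> in_open (O ∙ n) x ->
  exists k, forall z, is_real z -> in_ball z x k -> in_open (O ∙ n) z.
Hypothesis O_cover : forall x, is_real x -> in_unit x -> exists n, in_open (O ∙ n) x.

Definition lebesgue_number (k : num M) : Prop :=
  forall a b, is_real a -> is_real b -> in_unit a -> in_unit b -> in_ball a b k ->
  exists n, forall z, is_real z -> real_lt a z -> real_lt z b -> in_open (O ∙ n) z.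

Lemma not_lebesgue_numberP k : ~ lebesgue_number k -> exists a b,
  [/\ is_real a, is_real b, in_unit a & in_ball a b k] /\
  forall n, exists z, [/\ is_real z, real_lt a z, real_lt z b & ~ in_open (O ∙ n) z].
Proof.
move=> not_lebesgue; apply: contrapT => nex; apply: not_lebesgue => a b ra rb a01 _ ab.
apply: contrapT => ninside; apply: nex; exists a, b; split=> // n.
apply: contrapT => nescape; apply: ninside; exists n => z rz az zb.
by apply: contrapT => zO; apply: nescape; exists z.
Qed.

Lemma escape_code_ex k : ~ lebesgue_number k -> exists f, escape_code O f k.
Proof.
move=> /not_lebesgue_numberP[a [b [[ra rb a01 ab] escapes]]].
pose φ : fm [B; N; N; N; N ⇒ B ⇒ B] := escape_fm v4 v0 v1 v2 v3.
have [||Z ZP] := @arith_choice M _ φ [env k; a ∙ k; O] M_models.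
- by [].
- move=> n; have [z [rz az zb zO]] := escapes n; exists z; apply/sat_escape_fm.
  by split=> //; apply: between_near az zb.
exists (code_of (a ∙ k) Z); split; first by rewrite center_code.
by move=> n; have /sat_escape_fm := ZP n; rewrite center_code point_code.
Qed.

Section NoLebesgueNumber.
Hypothesis no_lebesgue_number : forall k, ~ lebesgue_number k.

Lemma escape_codes_ex : exists G : dom M (N ⇒ B), forall k, escape_code O (G ∙ k) k.
Proof.
pose φ : fm [B; N; N ⇒ B ⇒ B] := escape_code_fm v2 v0 v1.
have [||G G_escape] := @arith_choice M _ φ [env O] M_models.
- by [].
- move=> k; have [f fP] := escape_code_ex (@no_lebesgue_number k).
  by exists f; apply/sat_escape_code_fm.
by exists G => k; have /sat_escape_code_fm := G_escape k.
Qed.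

Variable G : dom M (N ⇒ B).
Hypothesis G_escape : forall k, escape_code O (G ∙ k) k.

(* The centers may be as small as -2 * 2^-k; the shift makes them nonnegative. *)
Definition shifted_center (k : num M) : F := qval (center (G ∙ k)) + 2 * pow2neg k.

Lemma shifted_center_ge0 k : 0 <= shifted_center k.
Proof. by have [/andP[lo _] _] := G_escape k; rewrite /shifted_center; lra. Qed.

Lemma shifted_center_le k : shifted_center k <= 1 + 4 * pow2neg k.
Proof. by have [/andP[_ hi] _] := G_escape k; rewrite /shifted_center; lra. Qed.

Definition frequently (d n : num M) : Prop :=
  forall K : num M, exists k : num M, ι K <= ι k /\ ι d * pow2neg n <= shifted_center k.

Definition frequently_fm Γ (g : tm Γ (N ⇒ B)) (d n : tm Γ N) : fm Γ :=
  ∀[N] ∃[N] leN v1 v0 ⊓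
    qle (dyadic (wk (wk d)) (wk (wk n)))
        (qadd (fstN (wk (wk g) ⋅ v0 ⋅ zero)) (dyadic two v0)).

Lemma sat_frequently_fm Γ (g : tm Γ (N ⇒ B)) (d n : tm Γ N) (ρ : env M Γ) :
  eval g ρ = G -> sat (frequently_fm g d n) ρ <-> frequently (eval d ρ) (eval n ρ).
Proof.
move=> gG; apply: sat_All_iff => K; apply: sat_Ex_iff => k.
rewrite sat_And sat_leN sat_qle qval_qadd qval_dyadic qval_dyadic2.
by rewrite eval_fstN !eval_App !eval_wk gG.
Qed.

Definition limsup_digit (d n : num M) : Prop :=
  frequently d n /\ ~ frequently (d + 1) n.

Lemma limsup_digit_ex n : exists d, limsup_digit d n.
Proof.
pose φ : fm [N; N; N ⇒ B] := frequently_fm v2 v0 v1.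
have φP d : sat φ [env d; n; G] <-> frequently d n by rewrite sat_frequently_fm.
have [||//|d [/φP d_freq Sd_nfreq]] :=
    @arith_last M (models_ACA0w M_models) _ φ [env n; G] (exp2 n * 5 + 1).
- by [].
- by apply/φP => K; exists K; rewrite lexx rmorph0 mul0r shifted_center_ge0.
- move=> /φP/(_ 0)[k [_]]; have := shifted_center_le k; have := pow2neg_gt0 n.
  have := pow2neg_le1 k; have := ι_exp2K n; rewrite rmorphD rmorphM rmorph1 rmorph_nat.
  by lra.
by exists d; split=> // /φP.
Qed.

Lemma limsup_digits_ex :
  exists D : dom M (N ⇒ B), forall n, limsup_digit (head (D ∙ n)) n.
Proof.
pose φ : fm [B; N; N ⇒ B] :=
  frequently_fm v2 (v0 ⋅ zero) v1 ⊓ Neg (frequently_fm v2 (succ (v0 ⋅ zero)) v1).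
have φP f n : sat φ [env f; n; G] <-> limsup_digit (head f) n.
  by rewrite sat_And sat_Neg !sat_frequently_fm // eval_succ.
have [||D D_limsup] := @arith_choice M _ φ [env G] M_models.
- by [].
- move=> n; have [d dP] := limsup_digit_ex n.
  by exists (eval (rconst v0) [env d]); apply/φP; rewrite /head eval_rconst.
by exists D => n; apply/φP.
Qed.

Variable D : dom M (N ⇒ B).
Hypothesis D_limsup : forall n, limsup_digit (head (D ∙ n)) n.

Definition limsup_approx (n : num M) : F := ι (head (D ∙ n)) * pow2neg n.

Lemma limsup_approx_frequently n (K : num M) :
  exists k : num M, ι K <= ι k /\ limsup_approx n <= shifted_center k.
Proof. by have [freq _] := D_limsup n; apply: freq. Qed.

Lemma limsup_approx_eventually n : exists K : num M,
  forall k : num M, ι K <= ι k -> shifted_center k < limsup_approx n + pow2neg n.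
Proof.
have [_ nfreq] := D_limsup n; apply: contrapT => nex; apply: nfreq => K.
apply: contrapT => nk; apply: nex; exists K => k le_Kk.
rewrite ltNge; apply/negP => ge_k; apply: nk; exists k; split=> //.
by rewrite ιD1 mulrDl mul1r.
Qed.

Lemma limsup_approx_lt m n : limsup_approx m < limsup_approx n + pow2neg n.
Proof.
have [K lt_n] := limsup_approx_eventually n.
have [k [le_Kk ge_m]] := limsup_approx_frequently m K.
exact: le_lt_trans ge_m (lt_n k le_Kk).
Qed.

Definition limsup : dom M B :=
  eval (lam (dyadic (v1 ⋅ succ v0 ⋅ zero) (succ v0))) [env D].

Lemma qval_limsup (n : num M) : qval (limsup ∙ n) = limsup_approx (n + 1).
Proof.
rewrite /limsup eval_lam qval_dyadic (eval_App _ zero) (eval_App _ (succ v0)).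
by rewrite !eval_succ.
Qed.

Lemma limsup_is_real : is_real limsup.
Proof.
move=> n m; rewrite !qval_limsup ltr_norml.
have := limsup_approx_lt (n + 1) (n + m + 1).
have := limsup_approx_lt (n + m + 1) (n + 1).
have : pow2neg (n + m + 1) <= pow2neg (n + 1).
  by apply: pow2neg_le; rewrite !rmorphD; have := ι_ge0 m; lra.
by rewrite !pow2negD1; have := pow2neg_gt0 n; lra.
Qed.

Lemma limsup_in_unit : in_unit limsup.
Proof.
move=> n; rewrite /near_unit qval_limsup.
have [k [le_nk ge_n]] := limsup_approx_frequently (n + 1) (n + 1).
have := shifted_center_le k; have := pow2neg_le le_nk; rewrite pow2negD1.
have : 0 <= limsup_approx (n + 1) by rewrite mulr_ge0 // ltW // pow2neg_gt0.
by have := pow2neg_gt0 n; lra.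
Qed.

Lemma point_near_limsup i : exists k : num M,
  forall n, in_ball (point (G ∙ k) n) limsup i.
Proof.
pose j : num M := i + 1 + 1 + 1 + 1.
have def_i : pow2neg i = 16 * pow2neg j by rewrite !pow2negD1; field.
have [K lt_j] := limsup_approx_eventually j.
have [k [le_k ge_j]] := limsup_approx_frequently j (j + K).
have [le_jk le_Kk] : ι j <= ι k /\ ι K <= ι k.
  by move: le_k; rewrite rmorphD; have := ι_ge0 j; have := ι_ge0 K; lra.
have pk_le_pj := pow2neg_le le_jk; have pk_gt0 := pow2neg_gt0 k.
exists k => n; exists k; have [_ /(_ n)[rz _ z_center]] := G_escape k.
rewrite qval_limsup def_i.
suff : `|qval (point (G ∙ k) n ∙ (k + 1)) - limsup_approx (k + 1 + 1)| < 14 * pow2neg j.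
  by lra.
have := limsup_approx_lt j (k + 1 + 1); have := limsup_approx_lt (k + 1 + 1) j.
have := is_real_near (m := k) (n := k + 1) rz; rewrite ιD1 lerDl ler01 => /(_ isT).
move: ge_j (lt_j k le_Kk) z_center; rewrite !pow2negD1 /shifted_center.
by rewrite !ltr_norml ler_norml; lra.
Qed.

End NoLebesgueNumber.

Lemma lebesgue_number_ex : exists k, lebesgue_number k.
Proof.
apply: contrapT => nex.
have [k le|G G_escape] := escape_codes_ex; first by apply: nex; exists k.
have [D D_limsup] := limsup_digits_ex G_escape.
have [n nP] := O_cover (limsup_is_real D_limsup) (limsup_in_unit G_escape D_limsup).
have [i near_in] := O_open (limsup_is_real D_limsup) nP.
have [k near] := point_near_limsup G_escape D_limsup i.
have [_ /(_ n)[rz zO _]] := G_escape k.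
exact/zO/near_in.
Qed.

End LebesgueNumber.

Lemma sat_isOpen_ball Γ (h : tm Γ (B ⇒ B)) (ρ : env M Γ) x :
  sat (isOpen h) ρ -> is_real x -> in_open (eval h ρ) x ->
  exists k, forall z, is_real z -> in_ball z x k -> in_open (eval h ρ) z.
Proof.
move=> [_ h_open] /(sat_isReal v0 (econs x ρ)) rx xh.
have [|k kP] := h_open x rx; first by apply/sat_mem; rewrite eval_wk.
exists k => z rz zx.
have : sat (mem v0 (wk (wk (wk h)))) (econs z (econs k (econs x ρ))).
  by apply: kP; [apply/sat_isReal|apply/sat_inBall].
by rewrite sat_mem !eval_wk.
Qed.

Lemma lebesgue_number_valid (O : dom M (N ⇒ B ⇒ B)) : models M ACA0w_QFAC01 ->
  sat (∀[N] isOpen (v1 ⋅ v0)) [env O] ->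
  sat (∀ℝ in01 v0 ⊃ ∃[N] mem v1 (v2 ⋅ v0)) [env O] ->
  sat (∃[N] ∀ℝ ∀ℝ
         in01 v1 ⊃ in01 v0 ⊃ inBall v1 v0 v2 ⊃
         ∃[N] ∀ℝ
           rlt v3 v0 ⊃ rlt v0 v2 ⊃
           mem v0 (v5 ⋅ v1)) [env O].
Proof.
move=> M_models O_open O_cover.
have [n x|x rx x01|k kP] := @lebesgue_number_ex M_models O.
- exact: (sat_isOpen_ball (O_open n)).
- have [||n /sat_mem] := O_cover x; [exact/sat_isReal|exact/sat_in01|by exists n].
exists k => a /sat_isReal ra b /sat_isReal rb /sat_in01 a01 /sat_in01 b01 /sat_inBall ab.
have [n nP] := kP a b ra rb a01 b01 ab.
exists n => z /sat_isReal rz /sat_rlt az /sat_rlt zb; exact/sat_mem/nP.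
Qed.

End Reals.

Theorem theorem2p18 :
  proves ACA0w_QFAC01
    (∀[N ⇒ B ⇒ B]
       (∀[N] isOpen (v1 ⋅ v0)) ⊃
       (∀ℝ in01 v0 ⊃ ∃[N] mem v1 (v2 ⋅ v0)) ⊃
       ∃[N] ∀ℝ ∀ℝ
         in01 v1 ⊃ in01 v0 ⊃ inBall v1 v0 v2 ⊃
         ∃[N] ∀ℝ
           rlt v3 v0 ⊃ rlt v0 v2 ⊃
           mem v0 (v5 ⋅ v1)).
Proof.
apply: (extensional_completeness ACA0w_QFAC01_sub) => [Γ ψ ax|M M_models O].
  by do 2!constructor.
have [F [ι [ι_inj ι_ge0]]] := num_embedding M.
exact: (lebesgue_number_valid ι_inj ι_ge0 M_models).
Qed.
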